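(* For $m\in\mathcal{A}^c_3$ define $p_2(m),p_3(m)\in\mathbb{F}$ by $p_2(m)=\tilde p_2(m)/\mathrm{Disc}(Q_m)$ and $p_3(m)=\tilde p_3(m)/\mathrm{Disc}(Q_m)$, and let $\nu:\mathcal{A}^c_3/GL(V)\to\mathbb{F}\times\mathbb{F}$ be the map given by $\nu(m)=(p_3(m),p_2(m))$. Let $\Gamma_{\mathrm{Cardano}}=\{(p_3,p_2)\in\mathbb{F}\times\mathbb{F} : 27p_3^2+4p_2^3=0\}$, and let $\mathbb{F}_{Q_m}$ denote a splitting field of $Q_m$. Then: (i) The map $\nu$ is surjective. (ii) Let $m_1,m_2\in\mathcal{A}^c_3$ be such that $\nu(m_1),\nu(m_2)\notin\Gamma_{\mathrm{Cardano}}$. Then there exists $g\in GL(V)$ such that $g\cdot m_1=m_2$ if and only if $\nu(m_1)=\nu(m_2)$. (iii) Let $m_1,m_2\in\mathcal{A}^c_3$ be such that $\nu(m_1),\nu(m_2)\in\Gamma_{\mathrm{Cardano}}$. Then there exists $g\in GL(V)$ such that $g\cdot m_1=m_2$ if and only if $\nu(m_1)=\nu(m_2)$ and $\mathbb{F}_{Q_{m_1}}\cong\mathbb{F}_{Q_{m_2}}$. (iv) Let $m\in\mathcal{A}^c_3$. (a) If $\nu(m)\in\Gamma_{\mathrm{Cardano}}\setminus\{(0,0)\}$ then $[\mathbb{F}_{Q_m}:\mathbb{F}]\le 2$. Conversely, if $(p_3,p_2)\in\Gamma_{\mathrm{Cardano}}\setminus\{(0,0)\}$ and $\mathbb{K}/\mathbb{F}$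 is an extension of degree at most two, then there exists $m\in\mathcal{A}^c_3$ such that $\nu(m)=(p_3,p_2)$ and $\mathbb{F}_{Q_m}\cong\mathbb{K}$. (b) If $\nu(m)=(0,0)$ then $[\mathbb{F}_{Q_m}:\mathbb{F}]=1,2,3$ or $6$. Conversely, if $\mathbb{K}/\mathbb{F}$ is a Galois extension of degree at most six, then there exists $m\in\mathcal{A}^c_3$ such that $\nu(m)=(0,0)$ and $\mathbb{F}_{Q_m}\cong\mathbb{K}$. (v) Let $m\in\mathcal{A}^c_3$. Then $m$ is associative if and only if $(p_3(m),p_2(m))=(16,-12)$. (vi) For $m\in\mathcal{A}^c_3$, the split automorphism group $\widetilde{\mathrm{Aut}}(m)=\{g\in GL(V\otimes_{\mathbb{F}}\mathbb{F}_{Q_m}) : g\cdot m=m\}$ is given by $$\widetilde{\mathrm{Aut}}(m)\cong\begin{cases}\{1\} & \text{if } \nu(m)\notin\Gamma_{\mathrm{Cardano}},\\ \mathbb{Z}_2 & \text{if } \nu(m)\in\Gamma_{\mathrm{Cardano}}\text{ and }\nu(m)\ne(0,0),\\ S_3 & \text{if } \nu(m)=(0,0).\end{cases}$$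
   Context: $\mathbb{F}$ is a field of characteristic different from $2$ and $3$, and $V$ is a two-dimensional $\mathbb{F}$-vector space. $L=\Lambda^2(V^* )$, $L^{-1}$ is its dual (identified with $\Lambda^2V$), $L^r$ denotes the $r$-th tensor power. $\mathcal{A}^c$ is the set of symmetric bilinear maps $m:V\times V\to V$ (commutative algebra structures on $V$). $GL(V)$ acts on $\mathcal{A}^c$ by $(g\cdot m)(v,w)=g\big(m(g^{-1}v,g^{-1}w)\big)$; for an extension $\mathbb{K}/\mathbb{F}$, $GL(V\otimes_{\mathbb F}\mathbb{K})$ acts similarly on bilinear maps on $V\otimes_{\mathbb F}\mathbb{K}$, and $m$ is extended $\mathbb{K}$-bilinearly. Let $(e_1,e_2)$ be a basis of $V$ with dual basis $(\epsilon_1,\epsilon_2)$, put $\omega=\epsilon_1\wedge\epsilon_2$, and write $m(e_1,e_1)=ae_1+be_2$, $m(e_2,e_2)=ce_1+de_2$, $m(e_1,e_2)=ee_1+fe_2$. The fundamental cubic is $Q_m(v)=m(v,v)\wedge v$; thus $Q_m(xe_1+ye_2)=q(x,y)\,e_1\wedge e_2$ with $q(x,y)=-bx^3+(a-2f)x^2y+(2e-d)xy^2+cy^3$. Writing $q=Ax^3+Bx^2y+Cxy^2+Dy^3$, $\mathrm{Disc}(Q_m)=(18ABCD+B^2C^2-4AC^3-4B^3D-27A^2D^2)\,\omega^2\in L^2$. Put $\mu(x,y)=q_{xx}q_{yy}-q_{xy}^2$ and $\tau=(d+e,-(a+f))$. Define $\tilde p_3(m)=-8\,q(\tau)\,\omega^2\in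 L^2$ and $\tilde p_2(m)=\mu(\tau)\,\omega^2\in L^2$. These do not depend on the basis, and $p_2,p_3$ are invariant under $GL(V)$, so $\nu$ is well defined on classes; we also write $\nu(m)$ for the value at the class of $m$. $\mathcal{A}^c_3=\{m\in\mathcal{A}^c : \mathrm{Disc}(Q_m)\ne0\}$ is the set of generic algebras. A splitting field of $Q_m$ is a smallest extension of $\mathbb{F}$ over which the binary cubic form $q$ factors into linear forms; it is well defined up to equivalence of field extensions of $\mathbb{F}$, and $\cong$ between extensions of $\mathbb{F}$ denotes this equivalence.
   Formalization: In the converse of (iv)(b), Gal(K/F) is additionally assumed isomorphic to a subgroup of S_3; as stated the claim fails, e.g. for the Galois extension F_{5^4}/F_5 of degree 4, since splitting fields of cubics have degree 1, 2, 3 or 6. *)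

(* Defs.v *)
From HB Require Import structures.
From mathcomp Require Import all_boot all_order all_fingroup all_algebra.
From mathcomp Require Import all_solvable all_field sesquilinear ring.
From mathcomp Require Import multinomials.mpoly.

Set Implicit Arguments.
Unset Strict Implicit.
Unset Printing Implicit Defensive.

Import GRing.Theory.
Local Open Scope ring_scope.

Section GeneralLinearAction.
Variables (F : fieldType) (V : vectType F).
Implicit Types (g : 'End(V)) (m : V -> V -> V).

Definition is_GL g := lker g == 0%VS.

Definition act g m : V -> V -> V := fun v w => g (m ((g^-1)%VF v) ((g^-1)%VF w)).

Definition same_orbit m1 m2 := exists2 g, is_GL g & act g m1 =2 m2.

Definition is_aut m g := is_GL g /\ act g m =2 m.

(* GL(V) is not a finite group in general, so "Aut(m) is isomorphic to G" is
   expressed by an injective morphism from G to GL(V) whose image is Aut(m). *)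
Definition aut_isog m (gT : finGroupType) (G : {group gT}) :=
  exists phi : gT -> 'End(V),
    [/\ {in G &, forall x y, phi (x * y)%g = (phi x \o phi y)%VF},
        {in G &, injective phi}
      & forall g, is_aut m g <-> exists2 x, x \in G & g = phi x].

End GeneralLinearAction.

Section BinaryCubics.
Variable F : fieldType.

Definition binary_cubic (A B C D : F) : {mpoly F[2]} :=
  A *: 'X_0 ^+ 3 + B *: ('X_0 ^+ 2 * 'X_1) + C *: ('X_0 * 'X_1 ^+ 2)
    + D *: 'X_1 ^+ 3.

Definition disc (A B C D : F) : F :=
  18 * A * B * C * D + B ^+ 2 * C ^+ 2 - 4 * A * C ^+ 3 - 4 * B ^+ 3 * D
    - 27 * A ^+ 2 * D ^+ 2.

Definition hessian (q : {mpoly F[2]}) : {mpoly F[2]} :=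
  q^`M(0)^`M(0) * q^`M(1)^`M(1) - q^`M(0)^`M(1) ^+ 2.

Definition factors_over (K : fieldExtType F) (E : {subfield K})
    (q : {mpoly F[2]}) :=
  exists alpha beta : 'I_3 -> K,
    (forall i, alpha i \in E /\ beta i \in E) /\
    map_mpoly (in_alg K) q = \prod_i (alpha i *: 'X_0 + beta i *: 'X_1).

(* Finite-dimensional extensions suffice: a smallest extension over which q
   factors is generated by the finitely many ratios of coefficients of its
   linear factors, which are algebraic over F. *)
Definition is_splitting_field (q : {mpoly F[2]}) (K : fieldExtType F) :=
  factors_over {:K}%AS q /\
  forall E : {subfield K}, factors_over E q -> (E : {vspace K}) = {:K}%VS.

Definition ext_equiv (K1 K2 : fieldExtType F) :=
  exists f : {lrmorphism K1 -> K2}, bijective f.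

Definition Cardano (p : F * F) := 27 * p.1 ^+ 2 + 4 * p.2 ^+ 3 == 0.

End BinaryCubics.

Section Invariants.
Variables (F : fieldType) (V : vectType F) (e : 2.-tuple V).
Implicit Types m : {bilinear V -> V -> V}.

Definition coef m (i j k : 'I_2) : F := coord e k (m e`_i e`_j).

(* With a, b, c, d, r, s the coordinates in m(e1,e1) = a e1 + b e2,
   m(e2,e2) = c e1 + d e2 and m(e1,e2) = r e1 + s e2, these are the
   coefficients of q(x,y), where m(v,v) /\ v = q(x,y) (e1 /\ e2) for
   v = x e1 + y e2; see fund_cubicE below. *)
Definition cubA m : F := - coef m 0 0 1.
Definition cubB m : F := coef m 0 0 0 - 2 * coef m 0 1 1.
Definition cubC m : F := 2 * coef m 0 1 0 - coef m 1 1 1.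
Definition cubD m : F := coef m 1 1 0.

Definition fund_cubic m : {mpoly F[2]} :=
  binary_cubic (cubA m) (cubB m) (cubC m) (cubD m).

Definition tau m (i : 'I_2) : F :=
  if i == 0 then coef m 1 1 1 + coef m 0 1 0
  else - (coef m 0 0 0 + coef m 0 1 1).

(* Elements of L^2 are represented by their coefficient of omega^2, where
   omega is the wedge of the basis dual to e. *)
Definition Disc m : F := disc (cubA m) (cubB m) (cubC m) (cubD m).
Definition p3_tilde m : F := - 8 * (fund_cubic m).@[tau m].
Definition p2_tilde m : F := (hessian (fund_cubic m)).@[tau m].

Definition nu m : F * F := (p3_tilde m / Disc m, p2_tilde m / Disc m).

Definition generic m := commutative m /\ Disc m != 0.

(* V tensor K is modelled by coordinate rows in the basis (e_i tensor 1). *)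
Definition tensor_in (K : fieldExtType F) (v : V) : 'rV[K]_2 :=
  \row_i (coord e i v)%:A.

Definition extend_scalars (K : fieldExtType F) m (x y : 'rV[K]_2) : 'rV[K]_2 :=
  \sum_i \sum_j (x 0 i * y 0 j) *: tensor_in K (m e`_i e`_j).

Definition wedge (v w : V) : F :=
  coord e 0 v * coord e 1 w - coord e 1 v * coord e 0 w.

Hypothesis e_basis : basis_of {:V} e.

Let eE v : v = coord e 0 v *: e`_0 + coord e 1 v *: e`_1.
Proof.
rewrite {1}(coord_basis e_basis (memvf v)) big_ord_recl big_ord1.
by congr (_ + coord e _ v *: _); apply/val_inj.
Qed.

Lemma bilinear_coordE m v w (k : 'I_2) :
  coord e k (m v w) = \sum_i \sum_j coord e i v * coord e j w * coef m i j k.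
Proof.
rewrite [in LHS](eE v) [in LHS](eE w) linearDr !linearDl !linearZl_LR /=.
rewrite !linearZr_LR /= !linearD !linearZ /= !big_ord_recl !big_ord0.
have -> : lift ord0 (ord0 : 'I_1) = 1 :> 'I_2 by apply/val_inj.
by rewrite /coef /=; ring.
Qed.

Lemma fund_cubicE m v : commutative m ->
  wedge (m v v) v = (fund_cubic m).@[fun i => coord e i v].
Proof.
move=> mC; rewrite /wedge !bilinear_coordE !big_ord_recl !big_ord0.
have -> : lift ord0 (ord0 : 'I_1) = 1 :> 'I_2 by apply/val_inj.
have cC k : coef m 1 0 k = coef m 0 1 k by rewrite /coef mC.
rewrite /fund_cubic /binary_cubic /cubA /cubB /cubC /cubD !cC.
rewrite !(mevalD, mevalZ, mevalM, mevalXU, rmorphXn) /=.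
by ring.
Qed.

Lemma extend_scalarsE (K : fieldExtType F) m v w :
  extend_scalars m (tensor_in K v) (tensor_in K w) = tensor_in K (m v w).
Proof.
apply/rowP => k; rewrite summxE mxE bilinear_coordE -[RHS]/(in_alg K _).
rewrite rmorph_sum; apply: eq_bigr => i _; rewrite summxE rmorph_sum.
by apply: eq_bigr => j _; rewrite !mxE !rmorphM.
Qed.

End Invariants.

(* Main.v *)
Require Import Defs.
From HB Require Import structures.
From mathcomp Require Import all_boot all_fingroup all_algebra.
From mathcomp Require Import all_solvable all_field sesquilinear ring.
From mathcomp Require Import multinomials.mpoly.

Set Implicit Arguments.
Unset Strict Implicit.
Unset Printing Implicit Defensive.

Import GRing.Theory.
Local Open Scope ring_scope.

(** A commutative product m on the plane has six structure constants. They are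
   equivalent, away from characteristic 3, to the four coefficients of the
   fundamental cubic q together with the two coordinates of tau, the trace form
   v |-> tr(m(v, _)) turned into a vector by the area form. In the coordinates
   (q, tau), called a datum below, g in GL_2 acts by pulling q back and dividing
   it by det g, and by applying the adjugate of g to tau; isomorphism of
   algebras is equivalence of data ([same_orbit_dat]). So everything reduces to
   finding normal forms of a binary cubic with a marked vector, which can be
   done by hand.

   If tau is nonzero it can be moved to (1, 0). Then p3 is the leading
   coefficient of q divided by its discriminant, up to the factor -8, and the
   matrices fixing tau are generated by the shears x + ty, which kill the
   coefficient of x^2 y (or that of x y^2, when p3 = 0), and by a one-parameter
   scaling. If p3 is nonzero, q becomes A x^3 + C x y^2 + D y^3, where C is
   determined by (p3, p2), and the value of p3 determines 4 C^3 + 27 A D^2; a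
   computation shows that D = 0 exactly on the Cardano curve. Off the curve, the
   scaling makes D equal to 1 and no freedom is left, so the orbit is determined
   by (p3, p2) and the stabiliser is trivial ([normal_noncardano],
   [stab_noncardano]). On the curve, q = x (A x^2 + C y^2) with C fixed, and the
   scaling multiplies A by squares: the stabiliser has order 2, and what remains
   is the class of A up to squares, that is the splitting field, generated by a
   square root of -AC ([normal_cardano], [kummer], [stab_cardano]). The
   associative algebras are those with C = 1/2 and D = 0 ([associative_nu]).

   The pair (p3, p2) is (0, 0) exactly when tau = 0, since a nondegenerate cubic
   and its Hessian have no common zero. Then only q matters, up to GL_2 and
   scalars. If q has a zero over F it is again equivalent to x (A x^2 + y^2).
   Otherwise it is equivalent to x^3 + P x y^2 + Q y^3, and for a root al the
   degree of the splitting field K over F(al) is at most 2; so a second such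
   cubic with splitting field K, which would remain irreducible over F(al) if it
   had no root there, has a root be in F(al). As 1, al, be, al be are linearly
   dependent in the cubic field F(al), be is the image of al under a Moebius
   transformation over F, and this transformation carries one cubic to the other
   ([split_cubic_equiv]). Over the splitting field all nondegenerate cubics are
   equivalent to -xy(x + y), whose stabiliser realises each permutation of the
   lines x, y, x + y exactly once ([stab_split]).

   Finally, isomorphic algebras have isomorphic splitting fields because the
   splitting field of a cubic is unique: an irreducible one is generated by the
   difference of two roots, which is a zero of an explicit sextic over F that
   splits in every other splitting field ([split_field_unique]). *)

(** * Two-by-two matrices *)

Definition det2 (R : comNzRingType) (g : 'M[R]_2) : R :=
  g 0 0 * g 1 1 - g 0 1 * g 1 0.

Lemma det_mx22 (R : comNzRingType) (g : 'M[R]_2) : \det g = det2 g.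
Proof.
rewrite (expand_det_row _ 0) !big_ord_recl big_ord0 /cofactor !det_mx11 !mxE.
have -> : lift ord0 (ord0 : 'I_1) = 1 :> 'I_2 by apply/val_inj.
have -> : lift 1 (0 : 'I_1) = 0 :> 'I_2 by apply/val_inj.
by rewrite /det2 /=; ring.
Qed.

Lemma unitmx22 (K : fieldType) (g : 'M[K]_2) : (g \in unitmx) = (det2 g != 0).
Proof. by rewrite unitmxE unitfE det_mx22. Qed.

Lemma sum_I2 (V : nmodType) (f : 'I_2 -> V) : \sum_i f i = f 0 + f 1.
Proof. by rewrite big_ord_recl big_ord1; congr (_ + f _); apply/val_inj. Qed.

Lemma mulmx22 (R : pzSemiRingType) (g h : 'M[R]_2) i j :
  (g *m h) i j = g i 0 * h 0 j + g i 1 * h 1 j.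
Proof. by rewrite mxE sum_I2. Qed.

Lemma ord2P (i : 'I_2) : {i = 0} + {i = 1}.
Proof. by case: i => [[|[|//]]] ?; [left | right]; apply/val_inj. Qed.

Definition mx22 (R : Type) (a b c d : R) : 'M[R]_2 :=
  \matrix_(i, j) if i == 0 then (if j == 0 then a else b)
                 else (if j == 0 then c else d).

Lemma mx22E (R : Type) (a b c d : R) : (mx22 a b c d 0 0 = a) *
  (mx22 a b c d 0 1 = b) * (mx22 a b c d 1 0 = c) * (mx22 a b c d 1 1 = d).
Proof. by rewrite !mxE. Qed.

Lemma mx22P (R : Type) (g h : 'M[R]_2) :
  g 0 0 = h 0 0 -> g 0 1 = h 0 1 -> g 1 0 = h 1 0 -> g 1 1 = h 1 1 -> g = h.
Proof.
move=> e00 e01 e10 e11; apply/matrixP => i j.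
by case: (ord2P i) => ->; case: (ord2P j) => ->.
Qed.

Lemma det2M (R : comNzRingType) (g h : 'M[R]_2) :
  det2 (g *m h) = det2 g * det2 h.
Proof. by rewrite -!det_mx22 det_mulmx. Qed.

Lemma det2_1 (R : comNzRingType) : det2 (1%:M : 'M[R]_2) = 1.
Proof. by rewrite -det_mx22 det1. Qed.

(** * Binary cubics with a marked vector *)

(** The cubic A x^3 + B x^2 y + C x y^2 + D y^3 with the vector (t, u). *)
Record datum (R : Type) :=
  Datum { dA : R; dB : R; dC : R; dD : R; dt : R; du : R }.

Lemma nat23_neq0 (K : fieldType) n : (2 : K) != 0 -> (3 : K) != 0 ->
  (0 < n)%N && all (mem [:: 2; 3]%N) (primes n) -> (n%:R : K) != 0.
Proof.
move=> n2 n3 /andP[n0 /allP n23]; rewrite natf_neq0_pchar /pnat n0.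
apply/allP => p /n23; rewrite !inE => /orP[] /eqP->.
- by apply/negP => /andP[_]; rewrite (negbTE n2).
- by apply/negP => /andP[_]; rewrite (negbTE n3).
Qed.

(** Proves that a product of elements known to be nonzero, and of numerals
   with no prime factor other than 2 and 3, is nonzero. *)
Ltac nz := repeat match goal with
  | |- is_true (_ && _) => apply/andP; split
  | |- is_true (- _ != _) => rewrite oppr_eq0
  | |- is_true (_^-1 != _) => rewrite invr_eq0
  | |- is_true (1 != _) => exact: oner_neq0
  | |- is_true (_%:R != _) =>
         apply: nat23_neq0; [assumption | assumption | done]
  | |- is_true (_ ^+ _ != _) => apply: expf_neq0
  | |- is_true (_ * _ != _) => first [assumption | apply: mulf_neq0]
  | |- is_true (_ != _) => assumption
  end.

Section Data.
Variable K : fieldType.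
Implicit Types (X Y Z : datum K) (g h : 'M[K]_2) (p : K * K).

Definition cubic X (x y : K) :=
  dA X * x ^+ 3 + dB X * x ^+ 2 * y + dC X * x * y ^+ 2 + dD X * y ^+ 3.

(** The action of GL_2: substitute g in the cubic, divide by det g, and apply
   the adjugate of g to the vector. It is a right action, [pullM]. *)
Definition pull g X : datum K :=
  let: Datum A B C D t u := X in
  let p := g 0 0 in let q := g 0 1 in let r := g 1 0 in let s := g 1 1 in
  Datum
   ((A * p ^+ 3 + B * p ^+ 2 * r + C * p * r ^+ 2 + D * r ^+ 3) / det2 g)
   ((3 * A * p ^+ 2 * q + B * (p ^+ 2 * s + 2 * p * q * r)
     + C * (q * r ^+ 2 + 2 * p * r * s) + 3 * D * r ^+ 2 * s) / det2 g)
   ((3 * A * p * q ^+ 2 + B * (q ^+ 2 * r + 2 * p * q * s)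
     + C * (p * s ^+ 2 + 2 * q * r * s) + 3 * D * r * s ^+ 2) / det2 g)
   ((A * q ^+ 3 + B * q ^+ 2 * s + C * q * s ^+ 2 + D * s ^+ 3) / det2 g)
   (s * t - q * u) (p * u - r * t).

Lemma cubic_pull g X x y : g \in unitmx ->
  cubic (pull g X) x y
    = cubic X (g 0 0 * x + g 0 1 * y) (g 1 0 * x + g 1 1 * y) / det2 g.
Proof.
rewrite unitmx22; case: X => A B C D t u.
by rewrite /cubic /pull /det2 /= => dg; field.
Qed.

Lemma pull1 X : pull 1%:M X = X.
Proof.
case: X => A B C D t u; rewrite /pull det2_1 !mxE /= !divr1.
by congr Datum; ring.
Qed.

Lemma pullM g h X : g \in unitmx -> h \in unitmx ->
  pull (g *m h) X = pull h (pull g X).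
Proof.
rewrite !unitmx22; case: X => A B C D t u dg dh.
rewrite /pull det2M !mulmx22; move: dg dh; rewrite /det2 => dg dh.
by congr (Datum _ _ _ _ _ _); field; rewrite ?dg ?dh.
Qed.

Definition discD X := disc (dA X) (dB X) (dC X) (dD X).

Definition p3D X := -8 * cubic X (dt X) (du X).

(** The Hessian of the cubic, at the marked vector. *)
Definition p2D X :=
  (6 * dA X * dt X + 2 * dB X * du X) * (2 * dC X * dt X + 6 * dD X * du X)
  - (2 * dB X * dt X + 2 * dC X * du X) ^+ 2.

Definition nuD X : K * K := (p3D X / discD X, p2D X / discD X).

Lemma discD_pull g X : g \in unitmx -> discD (pull g X) = det2 g ^+ 2 * discD X.
Proof.
rewrite unitmx22; case: X => A B C D t u.
by rewrite /discD /disc /pull /det2 /= => dg; field.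
Qed.

Lemma p3D_pull g X : g \in unitmx -> p3D (pull g X) = det2 g ^+ 2 * p3D X.
Proof.
rewrite unitmx22; case: X => A B C D t u.
by rewrite /p3D /cubic /pull /det2 /= => dg; field.
Qed.

Lemma p2D_pull g X : g \in unitmx -> p2D (pull g X) = det2 g ^+ 2 * p2D X.
Proof.
rewrite unitmx22; case: X => A B C D t u.
by rewrite /p2D /pull /det2 /= => dg; field.
Qed.

Lemma nuD_pull g X : g \in unitmx -> nuD (pull g X) = nuD X.
Proof.
move=> gU; rewrite /nuD discD_pull // p3D_pull // p2D_pull //.
have dg : det2 g ^+ 2 != 0 by rewrite expf_neq0 // -unitmx22.
by congr pair; rewrite -mulf_div divff // mul1r.
Qed.

Definition dequiv X Y := exists2 g, g \in unitmx & X = pull g Y.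

Lemma dequiv_refl X : dequiv X X.
Proof. by exists 1%:M; rewrite ?unitmx1 ?pull1. Qed.

Lemma dequiv_sym X Y : dequiv X Y -> dequiv Y X.
Proof.
case=> g gU ->; exists (invmx g); first by rewrite unitmx_inv.
by rewrite -pullM ?unitmx_inv // mulmxV // pull1.
Qed.

Lemma dequiv_trans X Y Z : dequiv X Y -> dequiv Y Z -> dequiv X Z.
Proof.
move=> [g gU ->] [h hU ->]; exists (h *m g); first by rewrite unitmx_mul hU.
by rewrite pullM.
Qed.

Lemma dequiv_pull g X : g \in unitmx -> dequiv X (pull g X).
Proof. by move=> gU; apply: dequiv_sym; exists g. Qed.

Lemma dequiv_mx X Y (p q r s : K) : p * s - q * r != 0 ->
  pull (mx22 p q r s) Y = X -> dequiv X Y.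
Proof.
move=> dg <-; exists (mx22 p q r s) => //.
by rewrite unitmx22 /det2 !mx22E.
Qed.

Lemma dequiv_nu X Y : dequiv X Y -> nuD X = nuD Y.
Proof. by case=> g gU ->; apply: nuD_pull. Qed.

Lemma dequiv_disc X Y : dequiv X Y -> (discD X != 0) = (discD Y != 0).
Proof.
case=> g gU ->; rewrite discD_pull // mulf_eq0 expf_eq0 /=.
by move: gU; rewrite unitmx22 => /negbTE->.
Qed.

(** For tau = 0 the action of the scalar matrices shows that only the class
   of the cubic up to scalars matters. *)
Lemma dequiv_scale g X Y c : g \in unitmx -> c != 0 ->
  dt X = 0 -> du X = 0 -> dt Y = 0 -> du Y = 0 ->
  dA (pull g Y) = c * dA X -> dB (pull g Y) = c * dB X ->
  dC (pull g Y) = c * dC X -> dD (pull g Y) = c * dD X -> dequiv X Y.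
Proof.
move=> gU c0 t0 u0 t0' u0' eA eB eC eD.
pose h := mx22 c^-1 0 0 c^-1.
have hU : h \in unitmx by rewrite unitmx22 /det2 !mx22E mul0r subr0; nz.
exists (g *m h); first by rewrite unitmx_mul gU.
rewrite pullM //; case: X Y t0 u0 t0' u0' eA eB eC eD.
move=> A B C D t u [A' B' C' D' t' u'] /= -> -> -> -> -> -> -> ->.
by rewrite /det2 !mx22E; congr Datum; field; nz.
Qed.

(** * Normal forms *)

Lemma normal_tau X : [\/ dt X = 0 /\ du X = 0 |
  exists Y, [/\ dequiv X Y, dt Y = 1 & du Y = 0]].
Proof.
case: X => A B C D t u /=.
have [t0|t0] := eqVneq t 0; last first.
  right; exists (pull (mx22 t 0 u t^-1) (Datum A B C D t u)); split.
  - apply: dequiv_pull; rewrite unitmx22 /det2 !mx22E mul0r subr0 divff //.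
    exact: oner_neq0.
  - by rewrite /pull !mx22E /=; field.
  - by rewrite /pull !mx22E /=; field.
have [u0|u0] := eqVneq u 0; first by left.
right; exists (pull (mx22 t (- u^-1) u 0) (Datum A B C D t u)); split.
- apply: dequiv_pull.
  by rewrite unitmx22 /det2 !mx22E mulr0 sub0r mulNr opprK mulVf ?oner_eq0.
- by rewrite /pull !mx22E /=; field.
- by rewrite /pull !mx22E /=; field.
Qed.

Lemma rescale u A B C D t : u != 0 ->
  dequiv (Datum A B C D t 0) (Datum (A * u ^+ 2) (B * u) C (D / u) t 0).
Proof.
move=> u0; apply: dequiv_sym; apply: (@dequiv_mx _ _ u 0 0 1).
  by rewrite mulr0 subr0 mulr1.
by rewrite /pull /det2 !mx22E; congr Datum; field; rewrite ?u0.
Qed.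

Lemma tau0_nu A B C D : nuD (Datum A B C D 0 0) = (0, 0).
Proof.
by rewrite /nuD /p3D /p2D /cubic /=; congr pair; apply/eqP;
  rewrite mulf_eq0; apply/orP; left; apply/eqP; ring.
Qed.

Lemma discD_depressed A C D t u :
  discD (Datum A 0 C D t u) = - A * (4 * C ^+ 3 + 27 * A * D ^+ 2).
Proof. by rewrite /discD /disc /=; ring. Qed.

Hypotheses (two_neq0 : (2 : K) != 0) (three_neq0 : (3 : K) != 0).

(** A shear along the first axis fixes tau. *)
Lemma shear A B C D t : A != 0 ->
  exists C' D' : K, dequiv (Datum A B C D t 0) (Datum A 0 C' D' t 0).
Proof.
move=> A0; pose q := - (B / (3 * A)).
exists (3 * A * q ^+ 2 + 2 * B * q + C), (A * q ^+ 3 + B * q ^+ 2 + C * q + D).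
apply: dequiv_sym; apply: (@dequiv_mx _ _ 1 q 0 1).
  by rewrite mulr0 subr0 mulr1 oner_eq0.
rewrite /pull /det2 !mx22E (_ : 1 * 1 - q * 0 = 1); last by ring.
rewrite !divr1; congr Datum; try ring.
by rewrite /q; field; rewrite ?three_neq0 ?A0.
Qed.

(** The value at (p3, p2) of the coefficient of x y^2 in the normal forms with
   tau = (1, 0) and no term x^2 y. *)
Definition midcoef p := - (2 * p.2) / (3 * p.1).

Lemma nuD_depressed A C D (n := 4 * C ^+ 3 + 27 * A * D ^+ 2) : A != 0 -> n != 0 ->
  nuD (Datum A 0 C D 1 0) = (8 / n, - (12 * C) / n).
Proof.
move=> A0 n0; rewrite /nuD discD_depressed /p3D /p2D /cubic /=.
by congr pair; rewrite /n; field; nz.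
Qed.

Lemma midcoef_depressed A C D : A != 0 -> discD (Datum A 0 C D 1 0) != 0 ->
  midcoef (nuD (Datum A 0 C D 1 0)) = C.
Proof.
move=> A0; rewrite discD_depressed mulf_eq0 negb_or => /andP[_ n0].
by rewrite nuD_depressed // /midcoef /=; field; nz.
Qed.

(** For such a form 27 p3^2 + 4 p2^3 is a nonzero multiple of A D^2. *)
Lemma Cardano_depressed A C D : A != 0 -> discD (Datum A 0 C D 1 0) != 0 ->
  Cardano (nuD (Datum A 0 C D 1 0)) = (D == 0).
Proof.
move=> A0; rewrite discD_depressed mulf_eq0 negb_or => /andP[_ n0].
rewrite nuD_depressed // /Cardano /=; set n := _ + _ in n0 *.
rewrite (_ : _ + _ = 1728 * 27 * A * D ^+ 2 / n ^+ 3); last by rewrite /n; field.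
have c0 : 1728 * 27 * A / n ^+ 3 != 0 by nz.
by rewrite mulrAC mulf_eq0 (negbTE c0) expf_eq0.
Qed.

(** p3 = 0 kills the leading coefficient, which makes the Hessian at tau a
   multiple of B^2; so p2 = 0 as well would make the discriminant vanish. *)
Lemma nu0_tau X : discD X != 0 -> nuD X = (0, 0) -> dt X = 0 /\ du X = 0.
Proof.
move=> dX nu0; have [//|[Y [eqXY t1 u0]]] := normal_tau X.
move: dX; rewrite (dequiv_disc eqXY) => dY.
move: nu0; rewrite (dequiv_nu eqXY) {eqXY}.
case: Y dY t1 u0 => A B C D t u /= dY -> -> [].
move/eqP; rewrite mulf_eq0 invr_eq0 (negbTE dY) orbF.
have n8 : (8 : K) != 0 by nz.
have n4 : (4 : K) != 0 by nz.
rewrite /p3D /cubic /= (_ : -8 * _ = -8 * A); last by ring.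
rewrite mulf_eq0 oppr_eq0 (negbTE n8) /= => /eqP A0.
move/eqP; rewrite mulf_eq0 invr_eq0 (negbTE dY) orbF.
rewrite /p2D /= A0 (_ : _ - _ = -4 * B ^+ 2); last by ring.
rewrite mulf_eq0 oppr_eq0 (negbTE n4) /= expf_eq0 /= => /eqP B0.
by move: dY; rewrite /discD /disc /= A0 B0; case/eqP; ring.
Qed.

Definition normal_datum p : datum K :=
  if p.1 == 0 then Datum 0 p.2^-1 0 1 1 0
  else Datum ((8 / p.1 - 4 * midcoef p ^+ 3) / 27) 0 (midcoef p) 1 1 0.

Lemma nuD_normal0 B D : B != 0 -> D != 0 ->
  nuD (Datum 0 B 0 D 1 0) = (0, (B * D)^-1).
Proof.
move=> B0 D0; rewrite /nuD /p3D /p2D /cubic /discD /disc /=; congr pair.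
  by rewrite !(mulr0, mul0r, addr0, add0r, expr0n).
rewrite (_ : _ - _ ^+ 2 = - (4 * B ^+ 2)); last by ring.
rewrite (_ : _ - _ * D ^+ 2 = - (4 * B ^+ 3 * D)); last by ring.
by field; nz.
Qed.

Lemma normal_noncardano X : discD X != 0 -> ~~ Cardano (nuD X) ->
  dequiv X (normal_datum (nuD X)).
Proof.
move=> dX nC; have [[t0 u0]|[Y [eqXY t1 u0]]] := normal_tau X.
  case: X t0 u0 dX nC => A B C D t u /= -> -> dX.
  by rewrite tau0_nu /Cardano /= !expr0n /= !mulr0 addr0 eqxx.
apply: dequiv_trans (eqXY) _.
move: dX nC; rewrite (dequiv_disc eqXY) (dequiv_nu eqXY) {eqXY}.
case: Y t1 u0 => A B C D t u /= -> -> {t u}.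
have [->|A0] := eqVneq A 0 => dY nC.
  have B0 : B != 0.
    by apply: contraNneq dY => ->; rewrite /discD /disc /=; apply/eqP; ring.
  (* The shear that completes the square in y (B x^2 + C x y + D y^2). *)
  pose q := C / (2 * B); pose E := D - C ^+ 2 / (4 * B).
  have eq1 : dequiv (Datum 0 B C D 1 0) (Datum 0 B 0 E 1 0).
    apply: dequiv_sym; apply: (@dequiv_mx _ _ 1 (- q) 0 1).
      by rewrite mulr0 subr0 mulr1 oner_eq0.
    rewrite /pull /det2 !mx22E (_ : 1 * 1 - - q * 0 = 1); last by ring.
    by rewrite !divr1 /q /E; congr Datum; try ring; field; nz.
  move: dY nC; rewrite (dequiv_nu eq1) (dequiv_disc eq1) => dY nC.
  apply: dequiv_trans eq1 _.
  have E0 : E != 0.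
    by apply: contraNneq dY => ->; rewrite /discD /disc /=; apply/eqP; ring.
  apply: dequiv_trans (rescale _ _ _ _ _ E0) _.
  rewrite nuD_normal0 // /normal_datum eqxx /= invrK divff // !mul0r.
  exact: dequiv_refl.
have [C' [D' eq1]] := shear B C D 1 A0.
move: dY nC; rewrite (dequiv_nu eq1) (dequiv_disc eq1) => dY.
rewrite Cardano_depressed // => D0.
apply: dequiv_trans eq1 _; apply: dequiv_trans (rescale _ _ _ _ _ D0) _.
rewrite /normal_datum midcoef_depressed //.
move: dY; rewrite discD_depressed mulf_eq0 negb_or => /andP[_ n0].
rewrite nuD_depressed //= mulf_eq0 invr_eq0 (negbTE n0) orbF.
rewrite ifN; last by nz.
rewrite mul0r divff // (_ : (_ - _) / _ = A * D' ^+ 2); last by field; nz.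
exact: dequiv_refl.
Qed.

Lemma normal_datum_nu p : ~~ Cardano p ->
  discD (normal_datum p) != 0 /\ nuD (normal_datum p) = p.
Proof.
case: p => p3 p2; rewrite /Cardano /normal_datum /=.
have [->|p3n0] := eqVneq p3 0 => nC.
  have p2n0 : p2 != 0 by apply: contraNneq nC => ->; apply/eqP; ring.
  split; last by rewrite nuD_normal0 ?oner_eq0 ?invr_eq0 // mulr1 invrK.
  rewrite /discD /disc /= (_ : _ - _ = - (4 * p2^-1 ^+ 3)); last by ring.
  by nz.
rewrite /midcoef /=; set A := (_ / 27); set C := (- _ / _).
have AE : A = 8 * (27 * p3 ^+ 2 + 4 * p2 ^+ 3) / (3 ^+ 6 * p3 ^+ 3).
  by rewrite /A /C; field; nz.
have A0 : A != 0 by rewrite AE; nz.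
have nE : 4 * C ^+ 3 + 27 * A * 1 ^+ 2 = 8 / p3 by rewrite /A /C; field; nz.
have n0 : 4 * C ^+ 3 + 27 * A * 1 ^+ 2 != 0 by rewrite nE; nz.
split; first by rewrite discD_depressed; nz.
by rewrite nuD_depressed // nE /C; congr pair; field; nz.
Qed.

Lemma Cardano_p1 p : Cardano p -> p <> (0, 0) -> p.1 != 0.
Proof.
case: p => p3 p2; rewrite /Cardano /= => /eqP cE p0; apply/eqP => p30.
have n4 : (4 : K) != 0 by nz.
apply: p0; rewrite p30; congr pair; move: cE; rewrite p30 expr0n mulr0 add0r.
by move/eqP; rewrite mulf_eq0 (negbTE n4) /= expf_eq0 => /eqP.
Qed.

Lemma cardano_datum_nu p A : Cardano p -> p.1 != 0 -> A != 0 ->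
  discD (Datum A 0 (midcoef p) 0 1 0) != 0 /\
  nuD (Datum A 0 (midcoef p) 0 1 0) = p.
Proof.
case: p => p3 p2; rewrite /Cardano /midcoef /= => /eqP cE p3n0 A0.
set C := (- _ / _).
have p2E : p2 ^+ 3 = - (27 * p3 ^+ 2) / 4.
  apply: (canRL (mulfK _)); first by nz.
  by apply/eqP; rewrite -subr_eq0 -cE; apply/eqP; ring.
have nE : 4 * C ^+ 3 + 27 * A * 0 ^+ 2 = 8 / p3.
  transitivity (- (32 * p2 ^+ 3) / (27 * p3 ^+ 3)); first by rewrite /C; field; nz.
  by rewrite p2E; field; nz.
have n0 : 4 * C ^+ 3 + 27 * A * 0 ^+ 2 != 0 by rewrite nE; nz.
split; first by rewrite discD_depressed; nz.
by rewrite nuD_depressed // nE /C; congr pair; field; nz.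
Qed.

Lemma nuD_onto p : exists X, discD X != 0 /\ nuD X = p.
Proof.
have [cp|ncp] := boolP (Cardano p); last first.
  by exists (normal_datum p); apply: normal_datum_nu.
have [->|/eqP p0] := eqVneq p (0, 0).
  exists (Datum 1 0 1 0 0 0); split; last exact: tau0_nu.
  by rewrite discD_depressed (_ : - 1 * _ = - 4); [nz | ring].
exists (Datum 1 0 (midcoef p) 0 1 0).
by apply: cardano_datum_nu; rewrite ?oner_eq0 ?Cardano_p1.
Qed.

Lemma normal_cardano X : discD X != 0 -> Cardano (nuD X) -> nuD X <> (0, 0) ->
  exists2 A : K, A != 0 & dequiv X (Datum A 0 (midcoef (nuD X)) 0 1 0).
Proof.
move=> dX cX nu0; have [[t0 u0]|[Y [eqXY t1 u0]]] := normal_tau X.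
  by case: nu0; case: X t0 u0 {dX cX} => A B C D t u /= -> ->; apply: tau0_nu.
move: dX cX nu0; rewrite (dequiv_disc eqXY) (dequiv_nu eqXY).
case: Y t1 u0 eqXY => A B C D t u /= -> -> eqXY dY cY nu0.
have A0 : A != 0.
  apply: contraNneq (Cardano_p1 cY nu0) => ->.
  rewrite mulf_eq0; apply/orP; left.
  by rewrite /p3D /cubic /=; apply/eqP; ring.
have [C' [D' eq1]] := shear B C D 1 A0.
move: dY cY; rewrite (dequiv_nu eq1) (dequiv_disc eq1) => dY.
rewrite Cardano_depressed // => /eqP D0; exists A => //.
apply: dequiv_trans eqXY _.
by rewrite midcoef_depressed //; move: eq1; rewrite D0.
Qed.

Definition has_zero X := exists x y : K, (x != 0) || (y != 0) /\ cubic X x y = 0.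

Lemma no_zero_dA X : ~ has_zero X -> dA X != 0.
Proof.
move=> zX; apply/eqP => A0; case: zX; exists 1, 0; rewrite oner_eq0; split=> //.
by rewrite /cubic A0; ring.
Qed.

Lemma dequiv_has_zero X Y : dequiv X Y -> has_zero X -> has_zero Y.
Proof.
move=> [g gU ->] [x [y [xy0]]]; rewrite cubic_pull //.
move: (gU); rewrite unitmx22 => dg /eqP.
rewrite mulf_eq0 invr_eq0 (negbTE dg) orbF => /eqP q0.
do 2! eexists; split; last exact: q0.
apply: contraLR xy0; rewrite !negb_or !negbK => /andP[/eqP e1 /eqP e2].
have xE : det2 g * x = 0.
  transitivity (g 1 1 * (g 0 0 * x + g 0 1 * y) - g 0 1 * (g 1 0 * x + g 1 1 * y)).
    by rewrite /det2; ring.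
  by rewrite e1 e2 !mulr0 subrr.
have yE : det2 g * y = 0.
  transitivity (g 0 0 * (g 1 0 * x + g 1 1 * y) - g 1 0 * (g 0 0 * x + g 0 1 * y)).
    by rewrite /det2; ring.
  by rewrite e1 e2 !mulr0 subrr.
by move/eqP: xE; move/eqP: yE; rewrite !mulf_eq0 (negbTE dg) /= => -> ->.
Qed.

(** Moving the zero to (0, 1) leaves x times a quadratic form, in which the
   square can be completed. *)
Lemma normal_has_zero X : discD X != 0 -> dt X = 0 -> du X = 0 -> has_zero X ->
  exists2 A : K, A != 0 & dequiv X (Datum A 0 1 0 0 0).
Proof.
move=> dX t0 u0 [x [y [xy0 q0]]].
have [g gU [Dg tg ug]] : exists2 g, g \in unitmx &
   [/\ dD (pull g X) = 0, dt (pull g X) = 0 & du (pull g X) = 0].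
  case: X t0 u0 q0 {dX} => A B C D t u /= -> ->; rewrite /cubic /= => q0.
  have [y0|] := boolP (y != 0).
    exists (mx22 1 x 0 y).
      by rewrite unitmx22 /det2 !mx22E mul1r mulr0 subr0.
    rewrite /pull /det2 !mx22E /=; split; [|ring|ring].
    by rewrite -[RHS](mul0r (1 * y - x * 0)^-1) -q0; congr (_ / _); ring.
  move: xy0; case: (y != 0); rewrite ?orbF // => x0 _.
  exists (mx22 0 x 1 y).
    by rewrite unitmx22 /det2 !mx22E mul0r sub0r oppr_eq0 mulr1.
  rewrite /pull /det2 !mx22E /=; split; [|ring|ring].
  by rewrite -[RHS](mul0r ((0 * y - x * 1)^-1)) -q0; congr (_ / _); ring.
have eq1 := dequiv_pull X gU.
move: dX; rewrite (dequiv_disc eq1) => dX.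
case: (pull g X) Dg tg ug eq1 dX => A B C D t u /= -> -> -> eq1 dX {D t u}.
have C0 : C != 0.
  by apply: contraNneq dX => ->; rewrite /discD /disc /=; apply/eqP; ring.
pose r := - B / (2 * C); pose A' := A + B * r + C * r ^+ 2.
have eq2 : dequiv (Datum A B C 0 0 0) (Datum (A' * C) 0 1 0 0 0).
  apply: dequiv_sym; apply: (@dequiv_mx _ _ 1 0 r (C^-1)).
    by rewrite mul1r mul0r subr0 invr_eq0.
  rewrite /pull /det2 !mx22E !(mul1r, mul0r, subr0).
  by congr Datum; rewrite /A' /r; field; nz.
exists (A' * C); last exact: dequiv_trans eq1 eq2.
by move: dX; rewrite (dequiv_disc eq2) discD_depressed; apply: contraNneq => ->;
  rewrite oppr0 mul0r.
Qed.

Lemma normal_monic X : dA X != 0 -> dt X = 0 -> du X = 0 ->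
  exists P Q : K, dequiv X (Datum 1 0 P Q 0 0).
Proof.
case: X => A B C D t u /= A0 -> ->.
have [C' [D' eq1]] := shear B C D 0 A0.
exists (C' / A), (D' / A); apply: dequiv_trans eq1 _.
apply: dequiv_sym; apply: (@dequiv_mx _ _ A^-1 0 0 A^-1).
  by rewrite mul0r subr0; nz.
by rewrite /pull /det2 !mx22E; congr Datum; field; nz.
Qed.

(** The linear factors are al_i x + be_i y. *)
Definition product3 (al be : 'I_3 -> K) (A B C D : K) :=
  [/\ A = al 0 * al 1 * al 2%R,
      B = al 0 * al 1 * be 2%R + al 0 * be 1 * al 2%R + be 0 * al 1 * al 2%R,
      C = al 0 * be 1 * be 2%R + be 0 * al 1 * be 2%R + be 0 * be 1 * al 2%R
    & D = be 0 * be 1 * be 2%R].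

(** The cubic -xy(x + y). *)
Definition split_datum : datum K := Datum 0 (-1) (-1) 0 0 0.

(** Multiplying each of three linear forms by the determinant of the other two
   gives forms L0, L1, L2 with sum 0; since det (L0, L1) is the product of the
   three determinants, q = L0 L1 L2 / det (L0, L1) is exactly a pullback of
   xy(-x - y). *)
Lemma normal_split X al be : discD X != 0 -> dt X = 0 -> du X = 0 ->
  product3 al be (dA X) (dB X) (dC X) (dD X) -> dequiv X split_datum.
Proof.
case: X => A B C D t u dX /= t0 u0; rewrite /product3.
move: (al 0) (al 1) (al 2%R) (be 0) (be 1) (be 2%R) => a0 a1 a2 b0 b1 b2.
move=> [AE BE CE DE].
pose d01 := a0 * b1 - a1 * b0; pose d12 := a1 * b2 - a2 * b1.
pose d20 := a2 * b0 - a0 * b2.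
have dE : discD (Datum A B C D t u) = (d01 * d12 * d20) ^+ 2.
  by rewrite /discD /disc /= AE BE CE DE /d01 /d12 /d20; ring.
move: dX; rewrite dE expf_eq0 /= !mulf_eq0 !negb_or.
move=> /andP[/andP[d01n d12n] d20n].
have gE : d12 * a0 * (d20 * b1) - d12 * b0 * (d20 * a1) = d12 * d20 * d01.
  by rewrite /d01; ring.
apply: (@dequiv_mx _ _ (d12 * a0) (d12 * b0) (d20 * a1) (d20 * b1)).
  by rewrite gE; nz.
rewrite /pull /det2 !mx22E gE AE BE CE DE t0 u0; congr Datum; try ring;
  apply: (canLR (mulfK _)); try nz; rewrite /d12 /d20 /d01; ring.
Qed.

End Data.

(** * Stabilisers *)

Section Stabilisers.
Variable K : fieldType.
Implicit Types (X Y : datum K) (g h : 'M[K]_2).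
Hypotheses (two_neq0 : (2 : K) != 0) (three_neq0 : (3 : K) != 0).

Definition stab_isog X (gT : finGroupType) (G : {group gT}) :=
  exists psi : gT -> 'M[K]_2,
    [/\ {in G &, forall x y, psi (x * y)%g = psi x *m psi y},
        {in G &, injective psi}
      & forall g, (g \in unitmx /\ pull g X = X) <->
                  exists2 x, x \in G & g = psi x].

Lemma dequiv_stab X Y (gT : finGroupType) (G : {group gT}) :
  dequiv X Y -> stab_isog Y G -> stab_isog X G.
Proof.
case=> h hU -> [psi [psiM psi_inj psiP]].
exists (fun x => invmx h *m psi x *m h); split=> [x y Gx Gy|x y Gx Gy|g].
- by rewrite psiM // -!mulmxA (mulKVmx hU).
- move/(congr1 (fun z => h *m z *m invmx h)).
  by rewrite -!mulmxA !(mulKVmx hU) !mulmxV // !mulmx1; apply: psi_inj.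
split=> [[gU gX]|[x Gx ->]].
  have [|x Gx xE] := (psiP (h *m g *m invmx h)).1.
    rewrite !unitmx_mul unitmx_inv hU gU; split=> //.
    rewrite !pullM ?unitmx_mul ?unitmx_inv ?hU // gX.
    by rewrite -pullM ?unitmx_inv // mulmxV // pull1.
  exists x => //; rewrite -xE -!mulmxA (mulVmx hU) mulmx1 mulmxA (mulVmx hU).
  by rewrite mul1mx.
have [] := (psiP (psi x)).2; first by exists x.
move=> xU xY; rewrite !unitmx_mul unitmx_inv hU xU; split=> //.
set k := _ *m h; have kU : k \in unitmx by rewrite !unitmx_mul unitmx_inv hU xU.
by rewrite -pullM // /k !mulmxA mulmxV // mul1mx pullM // xY.
Qed.

Lemma stab_noncardano X (gT : finGroupType) :
  discD X != 0 -> ~~ Cardano (nuD X) -> stab_isog X (1%G : {group gT}).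
Proof.
move=> dX nC; apply: (dequiv_stab (normal_noncardano two_neq0 three_neq0 dX nC)).
have [dN _] := normal_datum_nu two_neq0 three_neq0 nC.
exists (fun=> 1%:M); split=> [x y _ _|x y /set1gP-> /set1gP-> //|g].
  by rewrite mulmx1.
split=> [[gU gX]|[x _ ->]]; last by rewrite unitmx1 pull1.
exists 1%g; first exact: group1.
move: gU; rewrite unitmx22; move: dN gX; rewrite /normal_datum.
case: ifP => _; last first.
  move: (midcoef _) => C; move: ((_ - _) / _) => A dN [] eA eB eC eD es er.
  rewrite /det2 => dg.
  have A0 : A != 0.
    by apply: contraNneq dN => ->; rewrite /discD /disc /=; apply/eqP; ring.
  have s1 : g 1 1 = 1 by rewrite -es; ring.
  have r0 : g 1 0 = 0 by apply/eqP; rewrite -oppr_eq0 -er; apply/eqP; ring.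
  rewrite /det2 s1 r0 !(mulr0, subr0, mulr1) in dg eB eD.
  have q0 : g 0 1 = 0.
    move/eqP: eB; rewrite mulf_eq0 invr_eq0 (negbTE dg) orbF.
    rewrite (_ : _ + _ = 3 * A * g 0 0 ^+ 2 * g 0 1); last by ring.
    by rewrite !mulf_eq0 (negbTE three_neq0) (negbTE A0) (negbTE dg) => /eqP.
  have p1 : g 0 0 = 1.
    by move: eD; rewrite q0 => h; rewrite -[LHS]mulr1 -[in LHS]h; field.
  by apply: mx22P; rewrite ?mxE.
move: (_.2^-1) => B dN [] eA eB eC eD es er; rewrite /det2 => dg.
have B0 : B != 0.
  by apply: contraNneq dN => ->; rewrite /discD /disc /=; apply/eqP; ring.
have s1 : g 1 1 = 1 by rewrite -es; ring.
have r0 : g 1 0 = 0 by apply/eqP; rewrite -oppr_eq0 -er; apply/eqP; ring.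
rewrite /det2 s1 r0 !(mulr0, subr0, mulr1) in dg eB eC.
have p1 : g 0 0 = 1.
  by apply: (mulfI B0); rewrite mulr1 -[RHS]eB; field.
have q0 : g 0 1 = 0.
  move/eqP: eC; rewrite p1 divr1 (_ : _ + _ = 2 * B * g 0 1); last by ring.
  by rewrite !mulf_eq0 (negbTE two_neq0) (negbTE B0) => /eqP.
by apply: mx22P; rewrite ?mxE.
Qed.

Lemma stab_cardano X : discD X != 0 -> Cardano (nuD X) -> nuD X <> (0, 0) ->
  stab_isog X [set: 'Z_2]%G.
Proof.
move=> dX cX nz0; have [A A0 eqX] := normal_cardano two_neq0 three_neq0 dX cX nz0.
apply: (dequiv_stab eqX).
pose sg (x : 'Z_2) : K := if x == 0 then 1 else -1.
have N1 : (-1 : K) != 1.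
  by rewrite eq_sym -subr_eq0 opprK; exact: two_neq0.
exists (fun x => mx22 (sg x) 0 0 1); split=> [x y _ _|x y _ _ /matrixP/(_ 0 0)|g].
- apply: mx22P; rewrite mulmx22 !mx22E ?(mul0r, mulr0, addr0, add0r, mulr1) //.
  by case: (ord2P x) => ->; case: (ord2P y) => ->; rewrite /sg /= ?mulrNN ?mul1r ?mulr1.
- rewrite !mx22E /sg; case: (ord2P x) => ->; case: (ord2P y) => -> //= /eqP.
    by rewrite eq_sym (negbTE N1).
  by rewrite (negbTE N1).
split=> [[]|[x _ ->]].
  rewrite unitmx22 => dg [] eA eB _ _ es er.
  have s1 : g 1 1 = 1 by rewrite -es; ring.
  have r0 : g 1 0 = 0 by apply/eqP; rewrite -oppr_eq0 -er; apply/eqP; ring.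
  rewrite /det2 s1 r0 !(mulr0, subr0, mulr1) in dg eA eB.
  have q0 : g 0 1 = 0.
    move/eqP: eB; rewrite mulf_eq0 invr_eq0 (negbTE dg) orbF.
    rewrite (_ : _ + _ = 3 * A * g 0 0 ^+ 2 * g 0 1); last by ring.
    by rewrite !mulf_eq0 (negbTE three_neq0) (negbTE A0) (negbTE dg) => /eqP.
  have : g 0 0 ^+ 2 == 1.
    by apply/eqP/(mulfI A0); rewrite mulr1 -[RHS]eA; field.
  rewrite sqrf_eq1 => /orP[] /eqP p1; [exists 0 | exists 1] => //;
    by apply: mx22P; rewrite !mx22E ?p1 ?q0 ?r0 ?s1.
have sg0 : sg x != 0 by rewrite /sg; case: ifP; rewrite ?oppr_eq0 oner_eq0.
rewrite unitmx22 /det2 !mx22E mulr1 mulr0 subr0; split=> //.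
rewrite /pull /det2 !mx22E (_ : sg x * 1 - 0 * 0 = sg x); last by ring.
rewrite /sg; case: ifP => _.
  by rewrite !divr1; congr Datum; ring.
by rewrite !invrN1; congr Datum; ring.
Qed.

(** The linear forms x, y and z = -x-y; they have sum 0 and product the cubic
   of [split_datum]. *)
Definition form3 (j : 'I_3) (k : 'I_2) : K :=
  if j == 0 then (k == 0)%:R else if j == 1 then (k == 1)%:R else -1.

Lemma form3E : (form3 0 0 = 1) * (form3 0 1 = 0) * (form3 1 0 = 0) *
  (form3 1 1 = 1) * (form3 2%R 0 = -1) * (form3 2%R 1 = -1).
Proof. by []. Qed.

(** Permuting the forms x, y, z preserves their product, but it has determinant
   the sign of the permutation, so that it divides the cubic by that sign;
   rescaling the matrix by the sign corrects this. *)
Definition perm_form (s : 'S_3) : 'M[K]_2 :=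
  \matrix_(i, k) ((-1) ^+ s * form3 (s (widen_ord (leqnSn 2) i)) k).

Lemma I3P (j : 'I_3) : [\/ j = 0, j = 1 | j = 2%R].
Proof.
case: j => [[|[|[|//]]]] ?; [apply: Or31 | apply: Or32 | apply: Or33];
  exact/val_inj.
Qed.

Lemma perm3_eq (s t : 'S_3) : s 0 = t 0 -> s 1 = t 1 -> s = t.
Proof.
move=> e0 e1; apply/permP => j; case: (I3P j) => -> //.
have n0 : s 2%R != s 0 by rewrite (inj_eq perm_inj).
have n1 : s 2%R != s 1 by rewrite (inj_eq perm_inj).
have n2 : s 0 != s 1 by rewrite (inj_eq perm_inj).
have n0' : t 2%R != s 0 by rewrite e0 (inj_eq perm_inj).
have n1' : t 2%R != s 1 by rewrite e1 (inj_eq perm_inj).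
by move: n0 n1 n0' n1' n2; case: (I3P (s 0)) => ->; case: (I3P (s 1)) => -> //;
  case: (I3P (s 2%R)) => -> //; case: (I3P (t 2%R)) => ->.
Qed.

(** The order of the cases is that of [perm_form_mx]. *)
Lemma perm3_cases (s : 'S_3) (P : 'S_3 -> Prop) :
  P 1%g -> P (tperm 0%R 1%R) -> P (tperm 1%R 2%R) -> P (tperm 0%R 2%R) ->
  P (tperm 0%R 1%R * tperm 0%R 2%R)%g -> P (tperm 0%R 2%R * tperm 0%R 1%R)%g -> P s.
Proof.
move=> p1 p2 p3 p4 p5 p6.
have eqS (t : 'S_3) : s 0 = t 0 -> s 1 = t 1 -> P t -> P s.
  by move=> e0 e1 Pt; rewrite (perm3_eq e0 e1).
have n2 : s 0 != s 1 by rewrite (inj_eq perm_inj).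
move: n2; case: (I3P (s 0)) => e0; case: (I3P (s 1)) => e1; rewrite e0 e1 // => _;
  [ apply: eqS p1 | apply: eqS p3 | apply: eqS p2
  | apply: eqS p5 | apply: eqS p6 | apply: eqS p4];
  by rewrite ?e0 ?e1 ?permM ?perm1 ?permE.
Qed.

Lemma sum_form3 (s : 'S_3) k : form3 (s 0) k + form3 (s 1) k + form3 (s 2%R) k = 0.
Proof.
transitivity (\sum_j form3 (s j) k).
  rewrite !big_ord_recl big_ord0 addr0 addrA.
  by congr (_ + form3 (s _) k + form3 (s _) k); apply/val_inj.
rewrite (reindex_perm s^-1%g) /= (eq_bigr (fun j => form3 j k)).
  rewrite !big_ord_recl big_ord0 /form3 /=.
  by case: (ord2P k) => -> /=; ring.
by move=> j _; rewrite permKV.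
Qed.

Lemma perm_formM s t : perm_form (s * t)%g = perm_form s *m perm_form t.
Proof.
apply/matrixP => i k; rewrite mulmx22 !mxE permM odd_permM signr_addb.
have w0 : widen_ord (leqnSn 2) 0 = 0 by apply/val_inj.
have w1 : widen_ord (leqnSn 2) 1 = 1 by apply/val_inj.
rewrite w0 w1; have := sum_form3 t k; move: (s _) => j.
move: ((-1) ^+ s) ((-1) ^+ t) => es et.
case: (I3P j) => ->; rewrite !form3E;
  move: (form3 _ _) (form3 (t 1) _) (form3 (t 2%R) _) => a b c abc.
- by ring.
- by ring.
by rewrite (_ : c = - (a + b)); [ring | apply/eqP; rewrite -addr_eq0 addrC abc].
Qed.

Lemma form3_sgn_inj (b b' : bool) j j' :
  (forall k, (-1) ^+ b * form3 j k = (-1) ^+ b' * form3 j' k) -> j = j'.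
Proof.
have n0 : (1 : K) != 0 := oner_neq0 _.
have n1 : (-1 : K) != 0 by rewrite oppr_eq0.
have n2 : (-1 : K) != 1 by rewrite eq_sym -subr_eq0 opprK; exact: two_neq0.
move=> e; move: (e 0) (e 1).
case: b {e}; case: b'; rewrite !(expr0, expr1, mul1r, mulN1r);
case: (I3P j) => ->; case: (I3P j') => -> //;
  rewrite !form3E ?oppr0 ?opprK => /eqP + /eqP;
    rewrite 1?[0 == _]eq_sym 1?[1 == -1]eq_sym;
    rewrite ?(negbTE n0) ?(negbTE n1) ?(negbTE n2) //.
Qed.

Lemma perm_form_inj : injective perm_form.
Proof.
move=> s t /matrixP e.
have e0 : s 0 = t 0.
  apply: (@form3_sgn_inj s t) => k; move: (e 0 k); rewrite !mxE.
  by have -> : widen_ord (leqnSn 2) 0 = 0 by apply/val_inj.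
have e1 : s 1 = t 1.
  apply: (@form3_sgn_inj s t) => k; move: (e 1 k); rewrite !mxE.
  by have -> : widen_ord (leqnSn 2) 1 = 1 by apply/val_inj.
exact: perm3_eq.
Qed.

Lemma perm_formE s k : (perm_form s 0 k = (-1) ^+ s * form3 (s 0) k) *
  (perm_form s 1 k = (-1) ^+ s * form3 (s 1) k).
Proof.
rewrite !mxE; split; congr (_ * form3 (s _) _); exact/val_inj.
Qed.

Lemma perm_form_mx : (perm_form 1%g = mx22 1 0 0 1) *
  (perm_form (tperm 0 1) = mx22 0 (-1) (-1) 0) *
  (perm_form (tperm 1 2%R) = mx22 (-1) 0 1 1) *
  (perm_form (tperm 0 2%R) = mx22 1 1 0 (-1)) *
  (perm_form (tperm 0%R 1%R * tperm 0%R 2%R)%g = mx22 0 1 (-1) (-1)) *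
  (perm_form (tperm 0%R 2%R * tperm 0%R 1%R)%g = mx22 (-1) (-1) 1 0).
Proof.
by do !split; apply: mx22P; rewrite !perm_formE !mx22E
  ?odd_permM ?odd_tperm ?odd_perm1 ?permM ?perm1 ?permE /= ?form3E
    ?expr0 ?expr1 ?mul1r ?mulN1r ?oppr0 ?opprK.
Qed.

Lemma perm_form_split s :
  perm_form s \in unitmx /\ pull (perm_form s) (split_datum K) = split_datum K.
Proof.
have mxP p q r s' (d := p * s' - q * r) : d * d = 1 -> p * r * (p + r) = 0 ->
    p ^+ 2 * s' + 2 * p * q * r + (q * r ^+ 2 + 2 * p * r * s') = d ->
    q ^+ 2 * r + 2 * p * q * s' + (p * s' ^+ 2 + 2 * q * r * s') = d ->
    q * s' * (q + s') = 0 ->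
  mx22 p q r s' \in unitmx
    /\ pull (mx22 p q r s') (split_datum K) = split_datum K.
  move=> d2 eA eB eC eD.
  have d0 : d != 0.
    by apply: contraNneq (oner_neq0 K) => d0; rewrite -d2 d0 mulr0.
  rewrite unitmx22 /pull /det2 !mx22E -/d d0; split=> //.
  congr Datum; rewrite ?mulr0 ?subr0 //; apply: (canLR (mulfK d0)).
  - by rewrite [RHS]mul0r -[RHS]oppr0 -[X in _ = - X]eA; ring.
  - by rewrite -[X in _ = _ * X]eB; ring.
  - by rewrite -[X in _ = _ * X]eC; ring.
  - by rewrite [RHS]mul0r -[RHS]oppr0 -[X in _ = - X]eD; ring.
by elim/perm3_cases: s; rewrite perm_form_mx; apply: mxP; ring.
Qed.

(** As x^3 and y^3 do not occur in the substituted cubic, on each coordinate axis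
   one of the forms x, y, x + y composed with g vanishes; in the six cases where
   g is invertible the other two coefficients determine its entries. *)
Lemma split_perm_form g : g \in unitmx ->
  pull g (split_datum K) = split_datum K -> exists s, g = perm_form s.
Proof.
rewrite unitmx22 => dg [].
have num_eq (a b : K) : a / det2 g = b -> a = b * det2 g.
  by move=> <-; rewrite divfK.
move=> /num_eq eA /num_eq eB /num_eq eC /num_eq eD _ _.
have gE (p q r s : K) t : perm_form t = mx22 p q r s ->
    g 0 0 = p -> g 0 1 = q -> g 1 0 = r -> g 1 1 = s ->
    exists s, g = perm_form s.
  by move=> tE *; exists t; rewrite tE; apply: mx22P; rewrite !mx22E.
move: eA eB eC eD dg; rewrite /det2.
move: (g 0 0) (g 0 1) (g 1 0) (g 1 1) gE => p q r s gE eA eB eC eD dg.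
set d := p * s - q * r in eA eB eC eD dg.
have {}eA : p * r * (p + r) = 0.
  by transitivity (- (0 * d)); [rewrite -eA; ring | ring].
have {}eD : q * s * (q + s) = 0.
  by transitivity (- (0 * d)); [rewrite -eD; ring | ring].
have {}eB : p ^+ 2 * s + 2 * p * q * r + (q * r ^+ 2 + 2 * p * r * s) = d.
  by apply: oppr_inj; rewrite -[RHS]mulN1r -eB; ring.
have {}eC : q ^+ 2 * r + 2 * p * q * s + (p * s ^+ 2 + 2 * q * r * s) = d.
  by apply: oppr_inj; rewrite -[RHS]mulN1r -eC; ring.
rewrite {}/d in eB eC dg.
have solve (a b : K) : a != 0 -> a * b = 0 -> b = 0.
  by move=> a0 /eqP; rewrite mulf_eq0 (negbTE a0) => /eqP.
move/eqP: eA; rewrite !mulf_eq0 -orbA addr_eq0 => /or3P[] /eqP ep.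
- have qr : q * r != 0 by move: dg; rewrite ep mul0r sub0r oppr_eq0.
  have r1 : r = -1.
    apply/eqP; rewrite -addr_eq0; apply/eqP/(solve _ _ qr).
    by move/eqP: eB; rewrite -subr_eq0 => /eqP <-; rewrite ep; ring.
  move/eqP: eD; rewrite !mulf_eq0 -orbA addr_eq0 => /or3P[] /eqP es.
  + by move: qr; rewrite es mul0r eqxx.
  + have q1 : q = -1.
      apply/eqP; rewrite -addr_eq0; apply/eqP/(solve _ _ qr).
      by move/eqP: eC; rewrite -subr_eq0 => /eqP <-; rewrite ep es; ring.
    by apply: (gE _ _ _ _ (tperm 0 1)); rewrite ?perm_form_mx.
  + have s1 : s = -1.
      apply/eqP; rewrite -addr_eq0; apply/eqP/(solve _ _ qr).
      by move/eqP: eC; rewrite -subr_eq0 => /eqP <-; rewrite ep es; ring.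
    by apply: (gE _ _ _ _ (tperm 0%R 1%R * tperm 0%R 2%R)%g);
      rewrite ?perm_form_mx ?es ?s1 ?opprK.
- have ps : p * s != 0 by move: dg; rewrite ep mulr0 subr0.
  have p1 : p = 1.
    apply/eqP; rewrite -subr_eq0; apply/eqP/(solve _ _ ps).
    by move/eqP: eB; rewrite -subr_eq0 => /eqP <-; rewrite ep; ring.
  move/eqP: eD; rewrite !mulf_eq0 -orbA addr_eq0 => /or3P[] /eqP eq.
  + have s1 : s = 1.
      apply/eqP; rewrite -subr_eq0; apply/eqP/(solve _ _ ps).
      by move/eqP: eC; rewrite -subr_eq0 => /eqP <-; rewrite ep eq; ring.
    by apply: (gE _ _ _ _ 1%g); rewrite ?perm_form_mx.
  + by move: ps; rewrite eq mulr0 eqxx.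
  + have s1 : s = -1.
      apply/eqP; rewrite -addr_eq0; apply/eqP/(solve _ _ ps)/oppr_inj.
      by move/eqP: eC; rewrite -subr_eq0 oppr0 => /eqP <-; rewrite ep eq; ring.
    by apply: (gE _ _ _ _ (tperm 0 2%R)); rewrite ?perm_form_mx // eq s1 opprK.
have rE : r = - p by rewrite ep opprK.
have psq : p * (s + q) != 0.
  by move: dg; rewrite rE (_ : _ - _ = p * (s + q)) //; ring.
have p1 : p = -1.
  apply/eqP; rewrite -addr_eq0; apply/eqP/(solve _ _ psq)/oppr_inj.
  by move/eqP: eB; rewrite -subr_eq0 oppr0 => /eqP <-; rewrite rE; ring.
have r1 : r = 1 by rewrite rE p1 opprK.
move/eqP: eD; rewrite !mulf_eq0 -orbA addr_eq0 => /or3P[] /eqP eq.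
- have s0 : s != 0 by move: psq; rewrite eq addr0 mulf_eq0 negb_or => /andP[].
  have s1 : s = 1.
    apply/eqP; rewrite -subr_eq0; apply/eqP/(solve _ _ s0)/oppr_inj.
    by move/eqP: eC; rewrite -subr_eq0 oppr0 => /eqP <-; rewrite eq p1 r1; ring.
  by apply: (gE _ _ _ _ (tperm 1 2%R)); rewrite ?perm_form_mx.
- have q0 : q != 0 by move: psq; rewrite eq add0r mulf_eq0 negb_or => /andP[].
  have q1 : q = -1.
    apply/eqP; rewrite -addr_eq0; apply/eqP/(solve _ _ q0).
    by move/eqP: eC; rewrite -subr_eq0 => /eqP <-; rewrite eq p1 r1; ring.
  by apply: (gE _ _ _ _ (tperm 0%R 2%R * tperm 0%R 1%R)%g);
    rewrite ?perm_form_mx.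
by move: psq; rewrite eq addrN mulr0 eqxx.
Qed.

Lemma stab_split X : dequiv X (split_datum K) -> stab_isog X [set: 'S_3]%G.
Proof.
move=> /dequiv_stab; apply; exists perm_form; split=> [s t _ _|s t _ _|g].
- exact: perm_formM.
- exact: perm_form_inj.
split=> [[gU /(split_perm_form gU)[s ->]]|[s _ ->]]; first by exists s.
exact: perm_form_split.
Qed.

End Stabilisers.

(** * Algebra structures on a plane and their data *)

(** The k-th coordinate of the product of the i-th and j-th basis vectors. *)
Definition structure (R : Type) := 'I_2 -> 'I_2 -> 'I_2 -> R.

(** For a commutative structure this is the fundamental cubic together with tau. *)
Definition struct_datum (R : comNzRingType) (n : structure R) : datum R :=
  Datum (- n 0 0 1) (n 0 0 0 - 2 * n 0 1 1) (2 * n 0 1 0 - n 1 1 1) (n 1 1 0)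
        (n 1 1 1 + n 0 1 0) (- (n 0 0 0 + n 0 1 1)).

(** A plane with a basis e and dual coordinates co. This covers both V and the
   coordinate rows over an extension field. *)
Section Frame.
Variables (K : fieldType) (W : vectType K).
Variables (e : 'I_2 -> W) (co : 'I_2 -> W -> K).
Hypothesis co_lin : forall i, linear_for *%R (co i).
Hypothesis co_e : forall i j, co i (e j) = (i == j)%:R.
Hypothesis coE : forall v, v = co 0 v *: e 0 + co 1 v *: e 1.
Hypothesis three_neq0 : (3 : K) != 0.
Implicit Types (f g : 'End(W)) (A B : 'M[K]_2) (v w : W).

Let coD i v w : co i (v + w) = co i v + co i w.
Proof. by rewrite -[v in LHS]scale1r co_lin mul1r. Qed.

Let co0 i : co i 0 = 0.
Proof. by apply: (addrI (co i 0)); rewrite -coD !addr0. Qed.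

Let coZ i a v : co i (a *: v) = a * co i v.
Proof. by rewrite -[_ *: v]addr0 co_lin co0 addr0. Qed.

Lemma co_inj v w : (forall i, co i v = co i w) -> v = w.
Proof. by move=> eq_vw; rewrite [v]coE [w]coE !eq_vw. Qed.

Definition matr f : 'M[K]_2 := \matrix_(i, j) co i (f (e j)).

Definition endo_fun A v : W :=
  (A 0 0 * co 0 v + A 0 1 * co 1 v) *: e 0 + (A 1 0 * co 0 v + A 1 1 * co 1 v) *: e 1.

Fact endo_fun_linear A : linear (endo_fun A).
Proof.
move=> a v w; rewrite /endo_fun !co_lin scalerDr !scalerA addrACA -!scalerDl.
by congr (_ *: _ + _ *: _); ring.
Qed.

HB.instance Definition _ A :=
  GRing.isLinear.Build K W W _ (endo_fun A) (endo_fun_linear A).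

Definition endo A : 'End(W) := linfun (endo_fun A).

Lemma co_matr f i v : co i (f v) = matr f i 0 * co 0 v + matr f i 1 * co 1 v.
Proof.
by rewrite !mxE {1}[v]coE linearD !linearZ coD !coZ ![co _ v * _]mulrC.
Qed.

Lemma co_endo A i v : co i (endo A v) = A i 0 * co 0 v + A i 1 * co 1 v.
Proof.
rewrite lfunE /= /endo_fun coD !coZ !co_e.
by case: (ord2P i) => -> /=; rewrite ?mulr1 ?mulr0 ?addr0 ?add0r.
Qed.

Lemma endoK : cancel endo matr.
Proof.
move=> A; apply/matrixP => i j; rewrite mxE co_endo !co_e.
by case: (ord2P j) => -> /=; rewrite ?mulr1 ?mulr0 ?addr0 ?add0r.
Qed.

Lemma matrK : cancel matr endo.
Proof. by move=> f; apply/lfunP => v; apply: co_inj => i; rewrite co_endo co_matr. Qed.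

Lemma endoM A B : endo (A *m B) = (endo A \o endo B)%VF.
Proof.
apply/lfunP => v; apply: co_inj => i.
by rewrite comp_lfunE !co_endo !mulmx22; ring.
Qed.

Lemma endo1 : endo 1%:M = \1%VF.
Proof.
apply/lfunP => v; apply: co_inj => i; rewrite co_endo id_lfunE !mxE.
by case: (ord2P i) => -> /=; rewrite ?mul1r ?mul0r ?addr0 ?add0r.
Qed.

Lemma is_GL_matr f : is_GL f = (matr f \in unitmx).
Proof.
apply/idP/idP => [kf|fU].
  have /mulmx1_unit[] // : matr f *m matr (f^-1)%VF = 1%:M.
  apply: (can_inj endoK); rewrite endoM !matrK endo1; apply/lfunP => v.
  by rewrite comp_lfunE (lker0_lfunVK kf) id_lfunE.
apply/lker0P => v w eq_fvw.
have E x : x = endo (invmx (matr f)) (f x).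
  rewrite -[f in X in _ = endo _ X]matrK -comp_lfunE -endoM mulVmx // endo1.
  by rewrite id_lfunE.
by rewrite [v]E [w]E eq_fvw.
Qed.

Definition represents (M : W -> W -> W) (n : structure K) :=
  (forall v w k, co k (M v w) = \sum_i \sum_j co i v * co j w * n i j k)
  /\ (forall i j k, n i j k = n j i k).

(** The backward direction needs 3 to be invertible: the structure constants are
   recovered from the datum by solving a linear system of determinant a power
   of 3, up to sign. *)
Lemma intertwineP (M1 M2 : W -> W -> W) n1 n2 f :
  represents M1 n1 -> represents M2 n2 -> is_GL f ->
  (forall v w, f (M1 v w) = M2 (f v) (f w)) <->
    struct_datum n1 = pull (matr f) (struct_datum n2).
Proof.
move=> [M1E n1C] [M2E n2C]; rewrite is_GL_matr unitmx22 /det2 => dg.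
rewrite /struct_datum /pull /det2; move: (matr f) (co_matr f) dg => G GE dg.
have D (i j : 'I_2) : co i (e j) = (i == j)%:R := co_e i j.
have M1e i j k : co k (M1 (e i) (e j)) = n1 i j k.
  rewrite M1E !sum_I2 !D.
  by case: (ord2P i) => ->; case: (ord2P j) => -> /=;
    rewrite ?(mulr1, mulr0, mul1r, mul0r, addr0, add0r).
split=> [h|].
  have E i j k : G k 0 * n1 i j 0 + G k 1 * n1 i j 1 =
      \sum_p \sum_q G p i * G q j * n2 p q k.
    have := congr1 (co k) (h (e i) (e j)); rewrite GE !M1e => ->.
    rewrite M2E; apply: eq_bigr => p _; apply: eq_bigr => q _; rewrite !GE !D.
    by case: (ord2P i) => ->; case: (ord2P j) => -> /=;
      rewrite ?(mulr1, mulr0, addr0, add0r).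
  pose S i j k := \sum_p \sum_q G p i * G q j * n2 p q k.
  have n0 i j :
      n1 i j 0 = (G 1 1 * S i j 0 - G 0 1 * S i j 1) / (G 0 0 * G 1 1 - G 0 1 * G 1 0).
    by rewrite /S -!E; field.
  have n1' i j :
      n1 i j 1 = (G 0 0 * S i j 1 - G 1 0 * S i j 0) / (G 0 0 * G 1 1 - G 0 1 * G 1 0).
    by rewrite /S -!E; field.
  by rewrite !n0 !n1' /S !sum_I2 !(n2C 1 0); congr Datum; field.
move=> [eA eB eC eD et eu] v w; apply: co_inj => k.
rewrite GE M2E !M1E !sum_I2 !GE !(n1C 1 0) !(n2C 1 0).
(* Each constant of the source as a combination of the entries of its datum. *)
have e001 : n1 0 0 1 = - - n1 0 0 1 by rewrite opprK.
have e000 : n1 0 0 0 = ((n1 0 0 0 - 2 * n1 0 1 1) - 2 * - (n1 0 0 0 + n1 0 1 1)) / 3.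
  by field.
have e011 : n1 0 1 1 = - ((n1 0 0 0 - 2 * n1 0 1 1) + - (n1 0 0 0 + n1 0 1 1)) / 3.
  by field.
have e010 : n1 0 1 0 = ((2 * n1 0 1 0 - n1 1 1 1) + (n1 1 1 1 + n1 0 1 0)) / 3.
  by field.
have e111 : n1 1 1 1 = (2 * (n1 1 1 1 + n1 0 1 0) - (2 * n1 0 1 0 - n1 1 1 1)) / 3.
  by field.
rewrite eA in e001; rewrite eB eu in e000 e011; rewrite eC et in e010 e111.
rewrite e001 e000 e011 e010 e111 eD {e001 e000 e011 e010 e111 eA eB eC eD et eu}.
by case: (ord2P k) => ->; field; rewrite dg three_neq0.
Qed.

Lemma act_intertwine (M1 M2 : W -> W -> W) f : is_GL f ->
  Defs.act f M1 =2 M2 <-> (forall v w, f (M1 v w) = M2 (f v) (f w)).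
Proof.
move=> kf; split=> h v w.
  by rewrite -h /Defs.act !(lker0_lfunK kf).
by rewrite /Defs.act h !(lker0_lfunVK kf).
Qed.

Lemma same_orbit_dat (M1 M2 : W -> W -> W) n1 n2 :
  represents M1 n1 -> represents M2 n2 ->
  same_orbit M1 M2 <-> dequiv (struct_datum n1) (struct_datum n2).
Proof.
move=> r1 r2; split=> [[f kf /(act_intertwine _ _ kf)]|[A AU eqA]].
  move/(intertwineP r1 r2 kf) => eq12; exists (matr f) => //.
  by rewrite -is_GL_matr.
have kA : is_GL (endo A) by rewrite is_GL_matr endoK.
exists (endo A) => //; apply/(act_intertwine _ _ kA)/(intertwineP r1 r2 kA).
by rewrite endoK.
Qed.

Lemma aut_isog_dat (M : W -> W -> W) n (gT : finGroupType) (G : {group gT}) :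
  represents M n -> stab_isog (struct_datum n) G -> aut_isog M G.
Proof.
move=> r [psi [psiM psi_inj psiP]]; exists (fun x => endo (psi x)).
split=> [x y Gx Gy|x y Gx Gy /(can_inj endoK)|f].
- by rewrite psiM // endoM.
- exact: psi_inj.
split=> [[kf /(act_intertwine _ _ kf)/(intertwineP r r kf) eqf]|[x Gx ->]].
  have [|x Gx fE] := (psiP (matr f)).1; first by rewrite -is_GL_matr.
  by exists x => //; rewrite -fE matrK.
have [] := (psiP (psi x)).2; first by exists x.
move=> xU xE; have kx : is_GL (endo (psi x)) by rewrite is_GL_matr endoK.
split=> //; apply/(act_intertwine _ _ kx)/(intertwineP r r kx).
by rewrite endoK.
Qed.

(** The inverse of [struct_datum] on commutative structures. *)
Definition struct_of (X : datum K) : structure K := fun i j k =>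
  let b := (- (dB X + du X) / 3) in let a := (dC X + dt X) / 3 in
  if i == j then
    if i == 0 then if k == 0 then - du X - b else - dA X
    else if k == 0 then dD X else dt X - a
  else if k == 0 then a else b.

Lemma struct_ofK X : struct_datum (struct_of X) = X.
Proof.
case: X => A B C D t u; rewrite /struct_datum /struct_of /=.
by congr Datum; field.
Qed.

Definition product_fun (n : structure K) v w : W :=
  (\sum_i \sum_j co i v * co j w * n i j 0) *: e 0
  + (\sum_i \sum_j co i v * co j w * n i j 1) *: e 1.

Lemma product_fun_bilinear n :
  bilinear_for (GRing.Scale.Law.clone _ _ *:%R _)
    (GRing.Scale.Law.clone _ _ *:%R _) (product_fun n).
Proof.
split=> u a v w; rewrite /product_fun /= !sum_I2 !co_lin scalerDr !scalerA;
  rewrite [RHS]addrACA -!scalerDl; by congr (_ *: _ + _ *: _); ring.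
Qed.

HB.instance Definition _ n :=
  bilinear_isBilinear.Build K W W W _ _ (product_fun n) (product_fun_bilinear n).

Definition product n : {bilinear W -> W -> W} := product_fun n.

Lemma co_product n v w k :
  co k (product n v w) = \sum_i \sum_j co i v * co j w * n i j k.
Proof.
rewrite /product /= /product_fun coD !coZ !co_e.
by case: (ord2P k) => -> /=; rewrite mulr1 mulr0 ?addr0 ?add0r.
Qed.

Lemma productC n : (forall i j k, n i j k = n j i k) -> commutative (product n).
Proof.
move=> nC v w; apply: co_inj => k; rewrite !co_product !sum_I2 (nC 1 0); ring.
Qed.

End Frame.

(** * Splitting fields in terms of data *)

(** Locked, so that simplification does not turn it into a scaling of 1. *)
Fact emb_key : unit. Proof. exact: tt. Qed.
Definition emb (F : fieldType) (K : fieldExtType F) : {rmorphism F -> K} :=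
  locked_with emb_key (in_alg K : {rmorphism F -> K}).

Section SplittingData.
Variables (F : fieldType) (K : fieldExtType F).
Implicit Types (X Y : datum F) (E : {subfield K}).
Hypotheses (two_neq0 : (2 : F) != 0) (three_neq0 : (3 : F) != 0).

Local Notation io := (emb K).

Lemma embE c : io c = c%:A. Proof. by rewrite /emb unlock. Qed.

Lemma emb_mem E c : io c \in E.
Proof. by rewrite embE memvZ ?mem1v. Qed.

Lemma emb_inj : injective io. Proof. exact: fmorph_inj. Qed.

Lemma mem1_emb x : reflect (exists c, x = io c) (x \in 1%VS).
Proof. by apply: (iffP (vlineP _ _)) => [] [c ->]; exists c; rewrite embE. Qed.

Definition splits E X := exists al be : 'I_3 -> K,
  (forall i, al i \in E /\ be i \in E) /\
  product3 al be (io (dA X)) (io (dB X)) (io (dC X)) (io (dD X)).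

Definition is_split_field X :=
  splits {:K}%AS X /\ forall E, splits E X -> (E : {vspace K}) = {:K}%VS.

Lemma two_neq0K : (2 : K) != 0.
Proof. by rewrite -(rmorph_nat io) fmorph_eq0. Qed.
Lemma three_neq0K : (3 : K) != 0.
Proof. by rewrite -(rmorph_nat io) fmorph_eq0. Qed.

Lemma big_I3 (R : Type) (idx : R) (op : Monoid.law idx) (f : 'I_3 -> R) :
  \big[op/idx]_i f i = op (op (f 0) (f 1)) (f 2%R).
Proof.
rewrite !big_ord_recl big_ord0 Monoid.mulm1 Monoid.mulmA.
by congr (op (op (f _) (f _)) (f _)); apply/val_inj.
Qed.

(** The coefficients of a binary cubic are determined by its values at (1, 0),
   (0, 1), (1, 1) and (1, -1). *)
Lemma factors_overP E X :
  factors_over E (binary_cubic (dA X) (dB X) (dC X) (dD X)) <-> splits E X.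
Proof.
split=> [] [al [be [abE prodE]]]; exists al, be; split=> //.
  pose pt x y (i : 'I_2) : K := if i == 0 then x else y.
  pose q x y := io (dA X) * x ^+ 3 + io (dB X) * (x ^+ 2 * y)
    + io (dC X) * (x * y ^+ 2) + io (dD X) * y ^+ 3.
  have ev x y : q x y = (al 0 * x + be 0 * y) * (al 1 * x + be 1 * y)
                          * (al 2%R * x + be 2%R * y).
    have := congr1 (meval (pt x y)) prodE.
    rewrite big_I3 /= !mevalM !mevalD !mevalZ !mevalXU /pt /= => <-.
    rewrite /q /binary_cubic !embE !rmorphD /= !map_mpolyZ !(rmorphM, rmorphXn) /=.
    by rewrite !map_mpolyX !(mevalD, mevalZ, mevalM, rmorphXn) /= !mevalXU.
  have eA : io (dA X) = al 0 * al 1 * al 2%R.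
    by transitivity (q 1 0); [rewrite /q; ring | rewrite ev; ring].
  have eD : io (dD X) = be 0 * be 1 * be 2%R.
    by transitivity (q 0 1); [rewrite /q; ring | rewrite ev; ring].
  split=> //; apply: (mulfI two_neq0K).
    transitivity (q 1 1 - q 1 (-1) - 2 * io (dD X)); first by rewrite /q; ring.
    by rewrite !ev eD; ring.
  transitivity (q 1 1 + q 1 (-1) - 2 * io (dA X)); first by rewrite /q; ring.
  by rewrite !ev eA; ring.
case: prodE => eA eB eC eD; rewrite big_I3 /=.
rewrite /binary_cubic !rmorphD /= !map_mpolyZ !(rmorphM, rmorphXn) /= !map_mpolyX.
rewrite -!embE eA eB eC eD -!mul_mpolyC !(mpolyCD, mpolyCM); ring.
Qed.

Lemma is_split_fieldP X :
  is_splitting_field (binary_cubic (dA X) (dB X) (dC X) (dD X)) K <->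
  is_split_field X.
Proof.
by split=> [] [sK minK]; split=> [|E sE];
  first [exact/factors_overP | exact/minK/factors_overP].
Qed.

Lemma splits_dequiv E X Y : dequiv X Y -> splits E Y -> splits E X.
Proof.
case=> g; rewrite unitmx22 => dg -> [al [be [abE [eA eB eC eD]]]].
pose d i : K := if i == 0 :> 'I_3 then io (det2 g)^-1 else 1.
exists (fun i => d i * (al i * io (g 0 0) + be i * io (g 1 0))),
       (fun i => d i * (al i * io (g 0 1) + be i * io (g 1 1))).
have ioE c : io c \in E := emb_mem E c.
split=> [i|].
  have [aE bE] := abE i.
  have dE : d i \in E by rewrite /d; case: ifP => _; rewrite -?[1](rmorph1 io) ioE.
  by rewrite !(rpredM, rpredD).
rewrite /product3 /d /=; case: Y eA eB eC eD => A B C D t u /= eA eB eC eD.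
by split; rewrite !(rmorphM, rmorphD, rmorphXn, rmorph_nat) /= eA eB eC eD; ring.
Qed.

Lemma is_split_field_dequiv X Y : dequiv X Y -> is_split_field X <-> is_split_field Y.
Proof.
move=> eqXY; have eqYX := dequiv_sym eqXY.
split=> [] [sK minK]; split=> [|E /splits_dequiv sE].
- exact: splits_dequiv sK.
- exact/minK/sE.
- exact: splits_dequiv sK.
- exact/minK/sE.
Qed.

Lemma splits_quadratic A C t u E : A != 0 -> C != 0 ->
  splits E (Datum A 0 C 0 t u) <-> exists2 s, s \in E & s ^+ 2 = io (- (A * C)).
Proof.
move=> A0 C0; have ioE c : io c \in E := emb_mem E c.
have A0' : io A != 0 by rewrite fmorph_eq0.
split=> [[al [be [abE [/= eA eB eC eD]]]]|[s sE s2]].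
  have [a0 b0] := abE 0; have [a1 b1] := abE 1; have [a2 b2] := abE 2%R.
  rewrite rmorph0 in eB eD.
  have : al 0 != 0 /\ al 1 != 0 /\ al 2%R != 0.
    by move: A0'; rewrite eA !mulf_eq0 !negb_or => /andP[/andP[-> ->] ->].
  move: abE => _ [a0n [a1n a2n]].
  (* If a x (a' x + b' y) (a'' x + b'' y) has no term in x^2 y, then a a' b''
     is a square root of -AC. *)
  have sP (a a' a'' b' b'' : K) : a != 0 -> a * (a' * b'' + b' * a'') = 0 ->
      (a * a' * b'') ^+ 2 = - ((a * a' * a'') * (a * b' * b'')).
    move=> an0 /eqP; rewrite mulf_eq0 (negbTE an0) /= addrC addr_eq0 => /eqP e1.
    by transitivity (- (a * a' * b'' * a * (- (a' * b''))));
      [ring | rewrite -e1; ring].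
  move/esym/eqP: eD; rewrite !mulf_eq0 -orbA => /or3P[] /eqP b00.
  - exists (al 0 * al 1 * be 2%R); first by rewrite !rpredM.
    rewrite (sP _ _ (al 2%R) (be 1)) //; last by rewrite eB b00; ring.
    by rewrite rmorphN rmorphM /= eA eC b00; ring.
  - exists (al 1 * al 0 * be 2%R); first by rewrite !rpredM.
    rewrite (sP _ _ (al 2%R) (be 0)) //; last by rewrite eB b00; ring.
    by rewrite rmorphN rmorphM /= eA eC b00; ring.
  - exists (al 2%R * al 0 * be 1); first by rewrite !rpredM.
    rewrite (sP _ _ (al 1) (be 0)) //; last by rewrite eB b00; ring.
    by rewrite rmorphN rmorphM /= eA eC b00; ring.
(* x (x - s y / A) (A x + s y) *)
exists (fun i => if i == 2%R then io A else 1).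
exists (fun i => if i == 0 then 0 else if i == 1 then - (io A^-1 * s) else s).
split=> [i|].
  by split; do ?case: ifP => _; rewrite ?rpred0 ?rpredN ?rpredM ?rpred1 ?ioE.
split; rewrite /= ?rmorph0; try ring.
  by rewrite rmorphV ?unitfE //; field.
transitivity (- io A^-1 * s ^+ 2); last by ring.
by rewrite s2 rmorphV ?unitfE // rmorphN rmorphM; field.
Qed.

Lemma splits_cubic E B C D t u :
  splits E (Datum 1 B C D t u) <-> exists r : 'I_3 -> K,
   [/\ forall i, r i \in E, io B = - (r 0 + r 1 + r 2%R),
       io C = r 0 * r 1 + r 0 * r 2%R + r 1 * r 2%R & io D = - (r 0 * r 1 * r 2%R)].
Proof.
split=> [[al [be [abE [/= eA eB eC eD]]]]|[r [rE eB eC eD]]].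
  rewrite rmorph1 in eA.
  have /andP[/andP[a0 a1] a2] : (al 0 != 0) && (al 1 != 0) && (al 2%R != 0).
    by rewrite -!negb_or -!mulf_eq0 -eA oner_eq0.
  exists (fun i => - (be i / al i)); split=> [i||| ].
  - by have [? ?] := abE i; rewrite rpredN rpred_div.
  - transitivity (io B / (al 0 * al 1 * al 2%R)); first by rewrite -eA divr1.
    by rewrite eB; field; nz.
  - transitivity (io C / (al 0 * al 1 * al 2%R)); first by rewrite -eA divr1.
    by rewrite eC; field; nz.
  - transitivity (io D / (al 0 * al 1 * al 2%R)); first by rewrite -eA divr1.
    by rewrite eD; field; nz.
exists (fun=> 1), (fun i => - r i); split=> [i|]; first by rewrite rpred1 rpredN rE.
by split; rewrite /= ?rmorph1 ?eB ?eC ?eD; ring.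
Qed.

Lemma splits_root E B C D (r : 'I_3 -> K) x :
  (forall i, r i \in E) -> io B = - (r 0 + r 1 + r 2%R) ->
  io C = r 0 * r 1 + r 0 * r 2%R + r 1 * r 2%R -> io D = - (r 0 * r 1 * r 2%R) ->
  x ^+ 3 + io B * x ^+ 2 + io C * x + io D = 0 -> x \in E.
Proof.
move=> rE eB eC eD.
rewrite (_ : _ + _ = (x - r 0) * (x - r 1) * (x - r 2%R)); last first.
  by rewrite eB eC eD; ring.
by move/eqP; rewrite !mulf_eq0 !subr_eq0 -orbA => /or3P[] /eqP->.
Qed.

Lemma adjoin_degree_lt E x (p : {poly K}) : p \is a polyOver E -> p != 0 ->
  root p x -> (adjoin_degree E x < size p)%N.
Proof.
move=> Ep p0; apply: contraLR; rewrite -leqNgt => /(root_small_adjoin_poly Ep) ->.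
exact: p0.
Qed.

Lemma adjoin_degree_le2 E x c d : c \in E -> d \in E -> x ^+ 2 = c * x + d ->
  (adjoin_degree E x <= 2)%N.
Proof.
move=> cE dE x2; pose p : {poly K} := 'X^2 - (c *: 'X + d%:P).
have szr : (size (- (c *: 'X + d%:P)) < 3)%N.
  rewrite size_polyN (leq_ltn_trans (size_polyD _ _)) // gtn_max.
  rewrite (leq_ltn_trans (size_scale_leq _ _)) ?size_polyX //.
  by rewrite (leq_ltn_trans (size_polyC_leq1 _)).
have szp : size p = 3%N by rewrite /p size_polyDl size_polyXn.
rewrite -ltnS -szp; apply: adjoin_degree_lt.
- by rewrite rpredB ?rpredD ?polyOverZ ?polyOverC ?rpredX ?polyOverX.
- by rewrite -size_poly_eq0 szp.
by rewrite /root /p !hornerE x2 subrr.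
Qed.

Lemma adjoin1_poly x v n : (adjoin_degree 1%AS x <= n)%N -> v \in <<1; x>>%VS ->
  exists c : 'I_n -> F, v = \sum_i io (c i) * x ^+ i.
Proof.
move=> lex xv; have /polyOver1P[p pE] := Fadjoin_polyOver 1%AS x v.
exists (fun i => p`_i); rewrite -(Fadjoin_poly_eq xv) (@horner_coef_wide _ n).
  by apply: eq_bigr => i _; rewrite pE coef_map embE.
exact: leq_trans (size_Fadjoin_poly _ _ _) lex.
Qed.

Lemma adjoin_sqrt s d x : s ^+ 2 = io d -> x \in <<1; s>>%VS ->
  exists a b, x = io a + io b * s.
Proof.
move=> s2; have s2' : s ^+ 2 = 0 * s + io d by rewrite mul0r add0r.
have le2 := adjoin_degree_le2 (mem0v 1%AS) (emb_mem 1%AS d) s2'.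
case/(adjoin1_poly le2) => c ->; exists (c 0), (c 1).
by rewrite sum_I2 expr0 mulr1 expr1.
Qed.

Lemma split_field_quadratic A C t u : A != 0 -> C != 0 ->
  is_split_field (Datum A 0 C 0 t u) <->
  exists s, s ^+ 2 = io (- (A * C)) /\ <<1; s>>%VS = {:K}%VS.
Proof.
move=> A0 C0; split=> [[/splits_quadratic[] // s _ s2 minK]|[s [s2 sK]]].
  exists s; split=> //; apply: (minK <<1; s>>%AS).
  by apply/splits_quadratic => //; exists s; rewrite ?memv_adjoin.
split; first by apply/splits_quadratic => //; exists s; rewrite ?memvf.
move=> E /splits_quadratic[] // s' s'E s'2; apply/eqP.
rewrite eqEsubv subvf -sK sub_adjoin1v.
have /eqP := etrans s2 (esym s'2); rewrite -subr_eq0 subr_sqr mulf_eq0.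
by rewrite subr_eq0 addr_eq0 => /orP[]/eqP->; rewrite ?rpredN.
Qed.

Lemma dim_split_quadratic A C t u : A != 0 -> C != 0 ->
  is_split_field (Datum A 0 C 0 t u) -> (\dim {:K} <= 2)%N.
Proof.
move=> A0 C0 /split_field_quadratic[] // s [s2 <-].
have s2' : s ^+ 2 = 0 * s + io (- (A * C)) by rewrite mul0r add0r.
rewrite dim_Fadjoin dimv1 muln1.
exact: adjoin_degree_le2 (mem0v 1%AS) (emb_mem 1%AS _) s2'.
Qed.

(** If s2 = a + b s1 then s2^2 - a^2 - b^2 s1^2 = 2ab s1 lies in F, so a or b is
   zero unless s1 is in F already. *)
Lemma kummer s1 s2 d1 d2 :
  d1 != 0 -> d2 != 0 -> s1 ^+ 2 = io d1 -> s2 ^+ 2 = io d2 ->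
  <<1; s1>>%VS = {:K}%VS -> <<1; s2>>%VS = {:K}%VS ->
  exists2 u, u != 0 & d2 = d1 * u ^+ 2.
Proof.
move=> d10 d20 e1 e2 g1 g2.
have : s2 \in <<1; s1>>%VS by rewrite g1 memvf.
case/(adjoin_sqrt e1) => a [b s2E].
have [s1F|s1F] := boolP (s1 \in 1%VS).
  have /mem1_emb[c1 c1E] := s1F.
  have : s2 \in 1%VS by rewrite -(Fadjoin_idP s1F) g1 memvf.
  case/mem1_emb => c2 c2E.
  have d1E : d1 = c1 ^+ 2 by apply: emb_inj; rewrite -e1 c1E rmorphXn.
  have d2E : d2 = c2 ^+ 2 by apply: emb_inj; rewrite -e2 c2E rmorphXn.
  rewrite d1E d2E !expf_eq0 /= in d10 d20 *.
  by exists (c2 / c1); [rewrite mulf_neq0 ?invr_eq0 | field].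
have : 2 * a * b = 0.
  apply/eqP; apply: contraNT s1F => ab0; apply/mem1_emb.
  exists ((d2 - a ^+ 2 - b ^+ 2 * d1) / (2 * a * b)).
  have ab0' : io (2 * a * b) != 0 by rewrite fmorph_eq0.
  rewrite fmorph_div; apply: (canRL (mulfK ab0')).
  rewrite !(rmorphB, rmorphM, rmorphXn, rmorph_nat) /= -e1 -e2 s2E.
  by ring.
move/eqP; rewrite !mulf_eq0 (negbTE two_neq0) /= => /orP[]/eqP z0.
  rewrite z0 rmorph0 add0r in s2E.
  have d2E : d2 = d1 * b ^+ 2.
    by apply: emb_inj; rewrite -e2 s2E rmorphM rmorphXn -e1 exprMn mulrC.
  exists b => //; by apply: contraNneq d20 => b0; rewrite d2E b0 expr0n mulr0.
case/negP: s1F; have /Fadjoin_idP s2F : s2 \in 1%AS.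
  by rewrite s2E z0 rmorph0 mul0r addr0 emb_mem.
by have := memvf s1; rewrite -g2 s2F.
Qed.

Lemma split_quadratic_equiv A1 A2 C t :
  A1 != 0 -> A2 != 0 -> C != 0 ->
  is_split_field (Datum A1 0 C 0 t 0) -> is_split_field (Datum A2 0 C 0 t 0) ->
  dequiv (Datum A1 0 C 0 t 0) (Datum A2 0 C 0 t 0).
Proof.
move=> A10 A20 C0 /split_field_quadratic[] // s1 [e1 g1].
case/split_field_quadratic => // s2 [e2 g2].
have d10 : - (A1 * C) != 0 by nz.
have d20 : - (A2 * C) != 0 by nz.
have [u u0 e] := kummer d10 d20 e1 e2 g1 g2.
have -> : A2 = A1 * u ^+ 2.
  by apply: (mulIf C0); apply: oppr_inj; rewrite e; ring.
have := rescale A1 0 C 0 t u0.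
by rewrite !mul0r.
Qed.

Lemma exists_split_quadratic C t u : C != 0 -> (\dim {:K} <= 2)%N ->
  exists2 A, A != 0 & is_split_field (Datum A 0 C 0 t u).
Proof.
move=> C0 dimK.
suff [s [d [d0 s2 sK]]] : exists s d,
    [/\ d != 0, s ^+ 2 = io d & <<1; s>>%VS = {:K}%VS].
  have A0 : - d / C != 0 by nz.
  exists (- d / C) => //; apply/split_field_quadratic => //; exists s.
  by rewrite divfK // opprK.
have [K1|nK1] := eqVneq {:K}%VS 1%VS.
  exists 1, 1; rewrite expr1n rmorph1 oner_eq0; split=> //.
  by rewrite K1; apply/Fadjoin_idP/(mem1v 1%AS).
have [x xF] : exists x : K, x \notin 1%VS.
  have : ~~ ({:K} <= 1)%VS by apply: contra nK1 => h; rewrite eqEsubv h subvf.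
  by case/subvPn => x _ xF; exists x.
have le2 y : y \notin 1%VS -> <<1; y>>%VS = {:K}%VS /\ (adjoin_degree 1%AS y = 2)%N.
  move=> yF; have deg : (1 < adjoin_degree 1%AS y)%N.
    by rewrite ltn_neqAle eq_sym (adjoin_deg_eq1 1%AS y) yF.
  have dimy : \dim <<1; y>> = adjoin_degree 1%AS y by rewrite dim_Fadjoin dimv1 muln1.
  have le : (\dim <<1; y>> <= \dim {:K})%N by rewrite dimvS ?subvf.
  have eq2 : (adjoin_degree 1%AS y = 2)%N.
    by apply/eqP; rewrite eqn_leq deg -dimy (leq_trans le dimK).
  by split=> //; apply/eqP; rewrite eqEdim subvf dimy eq2 dimK.
have [xK degx] := le2 x xF.
have : x ^+ 2 \in <<1; x>>%VS by rewrite xK memvf.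
have degx' : (adjoin_degree 1%AS x <= 2)%N by rewrite degx.
case/(adjoin1_poly degx') => c; rewrite sum_I2 expr0 mulr1 expr1 => x2.
(* Completing the square in x^2 = c_1 x + c_0. *)
pose s := x - io (c 1 / 2); have sF : s \notin 1%VS.
  apply: contra xF => sF; rewrite -[x](subrK (io (c 1 / 2))).
  by rewrite (memvD sF) ?(emb_mem 1%AS).
have s2 : s ^+ 2 = io (c 0 + c 1 ^+ 2 / 4).
  have n2 := two_neq0K; have n3 := three_neq0K.
  rewrite /s sqrrB x2 rmorphD !fmorph_div rmorphXn !rmorph_nat.
  by field; nz.
exists s, (c 0 + c 1 ^+ 2 / 4); split => //; last by have [] := le2 s sF.
apply: contraNneq sF => d0; move/eqP: s2; rewrite d0 rmorph0 expf_eq0 => /eqP->.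
exact: (mem0v 1%AS).
Qed.

End SplittingData.

(** * Cubics without a zero *)

Section CubicFields.
Variables (F : fieldType) (K : fieldExtType F).
Implicit Types (X Y : datum F) (E : {subfield K}).
Hypotheses (two_neq0 : (2 : F) != 0) (three_neq0 : (3 : F) != 0).

Local Notation io := (emb K).

(** The roots of a monic cubic over E that has no root in E have degree 3. If
   r0^2 = c r0 + d with c and d in E, dividing the cubic by X^2 - c X - d leaves
   a remainder of degree at most 1 that vanishes at r0, hence is zero, and the
   linear quotient has its root in E. *)
Lemma cubic_adjoin_degree E (r0 r1 r2 : K) :
  r0 + r1 + r2 \in E -> r0 * r1 + r0 * r2 + r1 * r2 \in E -> r0 * r1 * r2 \in E ->
  r0 \notin E -> r1 \notin E -> r2 \notin E -> adjoin_degree E r0 = 3%N.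
Proof.
set s1 := r0 + r1 + r2; set s2 := _ + r1 * r2; set s3 := r0 * r1 * r2.
move=> s1E s2E s3E r0E r1E r2E; apply/eqP; rewrite eqn_leq; apply/andP; split.
  pose p := ('X - r0%:P) * ('X - r1%:P) * ('X - r2%:P).
  have szp : size p = 4%N.
    rewrite !size_Mmonic ?monicXsubC ?monicMl ?size_XsubC //.
    - by rewrite -size_poly_gt0 size_XsubC.
    by rewrite -size_poly_gt0 size_Mmonic ?monicXsubC -?size_poly_gt0 ?size_XsubC.
  rewrite -ltnS -szp; apply: adjoin_degree_lt.
  - have -> : p = 'X^3 - s1 *: 'X^2 + s2 *: 'X - s3%:P.
      rewrite /p /s1 /s2 /s3 -!mul_polyC !(polyCD, polyCM); ring.
    by do !apply: rpredD; rewrite ?rpredN ?polyOverZ ?polyOverC ?rpredX ?polyOverX.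
  - by rewrite -size_poly_gt0 szp.
  - by rewrite /root /p !hornerE subrr !mul0r.
rewrite ltnNge; apply/negP => le2.
have := Fadjoin_polyOver E r0 (r0 ^+ 2).
have r02 : r0 ^+ 2 \in <<E; r0>>%VS by rewrite rpredX ?memv_adjoin.
have := leq_trans (size_Fadjoin_poly E r0 (r0 ^+ 2)) le2.
have := Fadjoin_poly_eq r02; move: (Fadjoin_poly _ _ _) => p r02E szp /polyOverP pE.
have rE : r0 ^+ 2 = p`_1 * r0 + p`_0.
  by rewrite -r02E (horner_coef_wide _ szp) sum_I2 expr0 mulr1 expr1 addrC.
move: (pE 1%N) (pE 0%N) rE; move: p`_1 p`_0 => c d cE dE rE {p szp pE r02E}.
(* The linear quotient is X - e. *)
pose e := s1 - c.
have eE : e \in E by rewrite rpredB.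
have rem0 : (s2 - (c * e - d)) * r0 - (s3 + d * e) = 0.
  transitivity ((r0 - r0) * (r0 - r1) * (r0 - r2)
    - (r0 ^+ 2 - c * r0 - d) * (r0 - e)); first by rewrite /e /s1 /s2 /s3; ring.
  by rewrite rE; ring.
have a0 : s2 - (c * e - d) = 0.
  apply/eqP; apply: contraNT r0E => a0.
  rewrite (_ : r0 = (s3 + d * e) / (s2 - (c * e - d))).
    by rewrite rpred_div // ?rpredB ?(rpredD s3E) ?rpredB ?rpredM.
  by apply: (canRL (mulfK a0)); apply/eqP; rewrite -subr_eq0 mulrC rem0.
have b0 : s3 + d * e = 0.
  by apply: oppr_inj; rewrite oppr0 -rem0 a0 mul0r sub0r.
have : (e - r0) * (e - r1) * (e - r2) = 0.
  transitivity ((e ^+ 2 - c * e - d) * (e - e) + (s2 - (c * e - d)) * e - (s3 + d * e)).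
    by rewrite /e /s1 /s2 /s3; ring.
  by rewrite a0 b0; ring.
move/eqP; rewrite !mulf_eq0 !subr_eq0 -orbA => /or3P[]/eqP er.
- by rewrite er (negbTE r0E) in eE.
- by rewrite er (negbTE r1E) in eE.
- by rewrite er (negbTE r2E) in eE.
Qed.

Lemma no_zero_root B C D t u x : ~ has_zero (Datum 1 B C D t u) ->
  x ^+ 3 + io B * x ^+ 2 + io C * x + io D = 0 -> x \notin 1%VS.
Proof.
move=> nz0 x0; apply/negP => /mem1_emb[c cE]; case: nz0; exists c, 1.
rewrite oner_eq0 orbT; split=> //; apply: (@emb_inj _ K).
rewrite rmorph0 -x0 cE /cubic /= !(rmorphD, rmorphM, rmorphXn, rmorph1); ring.
Qed.

(** Two of the three roots generate, and once the first one is adjoined the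
   second one satisfies a quadratic equation. *)
Lemma split_cubic_adjoin B C D t u (r : 'I_3 -> K) :
  is_split_field K (Datum 1 B C D t u) ->
  io B = - (r 0 + r 1 + r 2%R) ->
  io C = r 0 * r 1 + r 0 * r 2%R + r 1 * r 2%R -> io D = - (r 0 * r 1 * r 2%R) ->
  <<<<1; r 0%R>>; r 1%R>>%VS = {:K}%VS /\
  (adjoin_degree <<1; r 0%R>>%AS (r 1%R) <= 2)%N.
Proof.
move=> [_ minK] eB eC eD; set E := <<1; r 0%R>>%AS.
have r0E : r 0 \in E by rewrite memv_adjoin.
split.
  apply: (minK <<E; r 1%R>>%AS); apply/splits_cubic; exists r; split=> // i.
  have r0E' : r 0 \in <<E; r 1%R>>%AS by rewrite subvP_adjoin.
  have r1E' : r 1 \in <<E; r 1%R>>%AS by rewrite memv_adjoin.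
  case: (I3P i) => -> //.
  have -> : r 2%R = - io B - r 0 - r 1 by rewrite eB; ring.
  by do !apply: rpredB => //; rewrite ?rpredN ?emb_mem.
have sE : r 1 + r 2%R \in E.
  have -> : r 1 + r 2%R = - io B - r 0 by rewrite eB; ring.
  by apply: rpredB => //; rewrite rpredN emb_mem.
apply: (@adjoin_degree_le2 _ _ E (r 1) (r 1 + r 2%R)
  (- (io C - r 0 * (r 1 + r 2%R)))) => //.
  by rewrite rpredN; apply: rpredB; rewrite ?emb_mem ?rpredM.
by rewrite eC; ring.
Qed.

Lemma adjoin1_cubic B C D t u (r : 'I_3 -> K) :
  ~ has_zero (Datum 1 B C D t u) ->
  io B = - (r 0 + r 1 + r 2%R) ->
  io C = r 0 * r 1 + r 0 * r 2%R + r 1 * r 2%R -> io D = - (r 0 * r 1 * r 2%R) ->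
  adjoin_degree 1%AS (r 0%R) = 3%N.
Proof.
move=> nz0 eB eC eD.
have rn x : (x - r 0) * (x - r 1) * (x - r 2%R) = 0 -> x \notin 1%VS.
  move=> x0; apply: (no_zero_root nz0); rewrite -x0 eB eC eD; ring.
apply: (@cubic_adjoin_degree 1%AS _ (r 1) (r 2%R)); last 1 first; try (apply: rn; ring).
- by rewrite -[_ + _]opprK -eB rpredN emb_mem.
- by rewrite -eC emb_mem.
- by rewrite -[_ * _]opprK -eD rpredN emb_mem.
Qed.

Lemma dim_split_cubic B C D t u : ~ has_zero (Datum 1 B C D t u) ->
  is_split_field K (Datum 1 B C D t u) -> \dim {:K} \in [:: 3; 6]%N.
Proof.
move=> nz0 sK; have [/splits_cubic[r [_ eB eC eD]] _] := sK.
have [genK deg2] := split_cubic_adjoin sK eB eC eD.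
rewrite -genK !dim_Fadjoin dimv1 muln1 (adjoin1_cubic nz0 eB eC eD).
by move: deg2; rewrite /adjoin_degree; case: (_.-1) => [|[|n]].
Qed.

Lemma adjoin3_free al (x y z : F) : adjoin_degree 1%AS (al : K) = 3%N ->
  io x + io y * al + io z * al ^+ 2 = 0 -> [/\ x = 0, y = 0 & z = 0].
Proof.
move=> deg3 xyz0; pose p : {poly K} := \poly_(i < 3) [:: io x; io y; io z]`_i.
have p0 : p == 0.
  rewrite -(@root_small_adjoin_poly _ _ 1%AS al) ?deg3 ?size_poly //.
    rewrite /root /p horner_poly big_I3 /= expr0 mulr1 expr1 xyz0; exact: eqxx.
  by apply/polyOverP => i; rewrite coef_poly;
    case: i => [|[|[|i]]] /=; rewrite ?rpred0 ?(emb_mem 1%AS).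
have coef0 i : p`_i = 0 by rewrite (eqP p0) coef0.
by split; apply: (@emb_inj _ K); rewrite rmorph0;
  [have := coef0 0%N | have := coef0 1%N | have := coef0 2%N]; rewrite coef_poly.
Qed.

(** Let al be a root of the first cubic. By degree the second one has a root be
   in F(al), say be = u + v al + w al^2. Then (w al - v) be = a al + b for some
   a and b in F, so be is the image of al under the Moebius transformation g
   with rows (a, b) and (w, -v). Its determinant is the value of the first cubic
   at (v, w), hence nonzero. The second cubic composed with g vanishes at al, so
   it is a multiple of the first one. *)
Lemma split_cubic_equiv P1 Q1 P2 Q2
    (X1 := Datum 1 0 P1 Q1 0 0) (X2 := Datum 1 0 P2 Q2 0 0) :
  discD X2 != 0 -> ~ has_zero X1 -> ~ has_zero X2 ->
  is_split_field K X1 -> is_split_field K X2 -> dequiv X1 X2.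
Proof.
move=> d2 nz1 nz2 sK1 sK2; have [/splits_cubic[r [_ eB eC eD]] _] := sK1.
have [/splits_cubic[r' [_ eB' eC' eD']] _] := sK2.
have [genK deg2] := split_cubic_adjoin sK1 eB eC eD.
have deg3 := adjoin1_cubic nz1 eB eC eD.
rewrite rmorph0 in eB eB'.
set al := r 0 in genK deg2 deg3; set E := <<1; al>>%AS in genK deg2.
have dimE : \dim E = 3%N by rewrite dim_Fadjoin dimv1 muln1 deg3.
have dimK : (\dim {:K} <= 6)%N.
  by rewrite -genK dim_Fadjoin dimE; apply: (leq_mul deg2 (leqnn 3)).
have al3 : al ^+ 3 = - (io P1 * al + io Q1).
  apply/eqP; rewrite -addr_eq0 eC eD; apply/eqP.
  transitivity (al ^+ 2 * (r 0 + r 1 + r 2%R)); first by rewrite /al; ring.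
  by rewrite -[_ + _ + _]opprK -eB oppr0 mulr0.
have [be [beE be0]] : exists be, be \in E /\ be ^+ 3 + io P2 * be + io Q2 = 0.
  have root i : r' i ^+ 3 + io P2 * r' i + io Q2 = 0.
    transitivity (r' i ^+ 2 * (r' 0 + r' 1 + r' 2%R)).
      by rewrite eC' eD'; case: (I3P i) => ->; ring.
    by rewrite -[_ + _ + _]opprK -eB' oppr0 mulr0.
  have [e0|n0] := boolP (r' 0 \in E); first by exists (r' 0).
  have [e1|n1] := boolP (r' 1 \in E); first by exists (r' 1).
  have [e2|n2] := boolP (r' 2%R \in E); first by exists (r' 2%R).
  have deg9 : adjoin_degree E (r' 0) = 3%N.
    apply: cubic_adjoin_degree n0 n1 n2.
    - by rewrite -[_ + _]opprK -eB' rpredN rpred0.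
    - by rewrite -eC' emb_mem.
    - by rewrite -[_ * _]opprK -eD' rpredN emb_mem.
  have : (\dim <<E; r' 0%R>> <= 6)%N by rewrite (leq_trans _ dimK) ?dimvS ?subvf.
  by rewrite dim_Fadjoin dimE deg9.
have be1 : be \notin 1%VS.
  by apply: (no_zero_root nz2); rewrite -be0 rmorph0; ring.
have deg3' : (adjoin_degree 1%AS al <= 3)%N by rewrite deg3.
have [u [v [w beE']]] : exists u v w, be = io u + io v * al + io w * al ^+ 2.
  have [c ->] := adjoin1_poly deg3' beE; exists (c 0), (c 1), (c 2%R).
  by rewrite big_I3 /= expr0 mulr1 expr1.
pose a := w * u - w ^+ 2 * P1 - v ^+ 2; pose b := - (w ^+ 2 * Q1 + u * v).
have rel : io a * al + io b = (io w * al - io v) * be.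
  rewrite beE'; transitivity (io w ^+ 2 * (al ^+ 3 + (io P1 * al + io Q1))
    + (io a * al + io b)).
    by rewrite al3; ring.
  rewrite /a /b !(rmorphB, rmorphN, rmorphD, rmorphM, rmorphXn); ring.
pose g := mx22 a b w (- v).
have dgE : det2 g = v ^+ 3 + P1 * v * w ^+ 2 + Q1 * w ^+ 3.
  by rewrite /det2 !mx22E /a /b; ring.
have dg : det2 g != 0.
  rewrite dgE; apply/eqP => z0; case: nz1; exists v, w; split; last first.
    by rewrite -z0 /cubic /=; ring.
  apply: contraR be1; rewrite negb_or !negbK => /andP[/eqP v0 /eqP w0].
  by rewrite beE' v0 w0 rmorph0 !mul0r !addr0 (emb_mem 1%AS).
have gU : g \in unitmx by rewrite unitmx22.
set Y := pull g X2.
have Yal : io (dA Y) * al ^+ 3 + io (dB Y) * al ^+ 2 + io (dC Y) * al + io (dD Y) = 0.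
  pose num := io a * al + io b; pose den := io w * al - io v.
  transitivity (den ^+ 3 * (be ^+ 3 + io P2 * be + io Q2) / io (det2 g)); last first.
    by rewrite be0 mulr0 mul0r.
  transitivity ((num ^+ 3 + io P2 * num * den ^+ 2 + io Q2 * den ^+ 3)
    / io (det2 g)); last by rewrite /num rel /den; ring.
  rewrite /num /den /Y /pull /= !mx22E; move: (det2 g) dg => dt dt0.
  rewrite !fmorph_div.
  rewrite !(rmorphD, rmorphN, rmorphM, rmorphXn, rmorph1, rmorph0, rmorph_nat) /=.
  by ring.
have [yD yC yB] : [/\ dD Y - dA Y * Q1 = 0, dC Y - dA Y * P1 = 0 & dB Y = 0].
  apply: (adjoin3_free deg3); rewrite -[RHS]Yal al3 !(rmorphB, rmorphM); ring.
have Y0 : dA Y != 0.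
  have : discD Y != 0 by rewrite discD_pull // mulf_neq0 ?expf_neq0.
  apply: contraNneq => yA; move: yD yC; rewrite yA !mul0r !subr0 => yD yC.
  by rewrite /discD yA yB yC yD /disc; apply/eqP; ring.
apply: (dequiv_scale gU Y0) => //; rewrite -/Y [X in _ = _ * X]/= ?mulr1 //.
- by rewrite yB mulr0.
- by apply/eqP; rewrite -subr_eq0 yC.
- by apply/eqP; rewrite -subr_eq0 yD.
Qed.

End CubicFields.

(** * Uniqueness of the splitting field of a cubic *)

Section SplittingFieldUnique.
Variable F : fieldType.
Implicit Types (K L : fieldExtType F) (X Y : datum F).
Hypotheses (two_neq0 : (2 : F) != 0) (three_neq0 : (3 : F) != 0).

(** Choosing for every element of K a polynomial whose value at x it is, and
   evaluating that polynomial at y, does not depend on the choice. *)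
Lemma simple_ext_hom K L (x : K) (y : L) : <<1; x>>%VS = {:K}%VS ->
  (forall p : {poly F},
     (map_poly (emb K) p).[x] = 0 -> (map_poly (emb L) p).[y] = 0) ->
  exists f : {lrmorphism K -> L},
    forall p, f (map_poly (emb K) p).[x] = (map_poly (emb L) p).[y].
Proof.
move=> genK ker.
have embP (M : fieldExtType F) : emb M =1 in_alg M by move=> c; rewrite embE.
have ex z : exists p : {poly F}, z == (map_poly (emb K) p).[x].
  have : z \in <<1; x>>%VS by rewrite genK memvf.
  by case/Fadjoin1_polyP => p ->; exists p; rewrite (eq_map_poly (embP K)).
pose P z := xchoose (ex z).
have PE z : z = (map_poly (emb K) (P z)).[x] by apply/eqP/(xchooseP (ex z)).
pose f z := (map_poly (emb L) (P z)).[y].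
have fE p : f (map_poly (emb K) p).[x] = (map_poly (emb L) p).[y].
  apply/eqP; rewrite -subr_eq0 /f -hornerN -hornerD -rmorphN -rmorphD.
  by apply/eqP/ker; rewrite rmorphD rmorphN hornerD hornerN -PE subrr.
have f_add : zmod_morphism f.
  move=> a b; rewrite {1}[a]PE {1}[b]PE -hornerN -hornerD -rmorphN -rmorphD fE.
  by rewrite rmorphD rmorphN hornerD hornerN.
have f_mul : monoid_morphism f.
  split=> [|a b].
    have -> : (1 : K) = (map_poly (emb K) 1).[x] by rewrite rmorph1 hornerC.
    by rewrite fE rmorph1 hornerC.
  by rewrite {1}[a]PE {1}[b]PE -hornerM -rmorphM fE rmorphM hornerM.
have f_scal : scalable f.
  move=> c a; have -> : c *: a = (map_poly (emb K) (c *: P a)).[x].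
    by rewrite map_polyZ hornerZ -PE embE mulr_algl.
  by rewrite fE map_polyZ hornerZ embE mulr_algl.
pose fA := GRing.isZmodMorphism.Build _ _ f f_add.
pose fM := GRing.isMonoidMorphism.Build _ _ f f_mul.
pose fZ := GRing.isScalable.Build _ _ _ _ f f_scal.
pose fLR : {lrmorphism K -> L} := HB.pack f fA fM fZ.
by exists fLR.
Qed.

(** The minimal polynomial of x divides R, hence has a zero y among the ys, and
   x can be sent to y. *)
Lemma root_ext_hom K L (x : K) (R : {poly F}) (ys : seq L) :
  <<1; x>>%VS = {:K}%VS ->
  root (map_poly (emb K) R) x ->
  map_poly (emb L) R = \prod_(y <- ys) ('X - y%:P) ->
  exists f : {lrmorphism K -> L}, True.
Proof.
move=> genK Rx RL.
have embP (M : fieldExtType F) : emb M =1 in_alg M by move=> c; rewrite embE.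
have /polyOver1P[f fE] := minPolyOver 1%AS x.
rewrite -(eq_map_poly (embP K)) in fE.
have dvd p : root (map_poly (emb K) p) x -> f %| p.
  move=> px; rewrite -(dvdp_map (emb K)) -fE minPoly_dvdp //.
  by rewrite (eq_map_poly (embP K)) alg_polyOver.
have fR : map_poly (emb L) f %| \prod_(y <- ys) ('X - y%:P).
  by rewrite -RL dvdp_map dvd.
have [m fm] := dvdp_prod_XsubC fR.
have szf : (1 < size f)%N.
  by rewrite -(size_map_poly (emb K)) -fE size_minPoly ltnS.
have [y fy] : exists y, root (map_poly (emb L) f) y.
  have := eqp_size fm; rewrite size_map_poly size_prod_XsubC => szm.
  case: (mask m ys) fm szm => [|y s] fm szm; first by rewrite szm in szf.
  by exists y; rewrite (eqp_root fm) big_cons rootM root_XsubC eqxx.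
have [|g _] := @simple_ext_hom K L x y genK; last by exists g.
by move=> p /eqP/dvd fp; rewrite -(divpK fp) rmorphM hornerM (rootP fy) mulr0.
Qed.

Lemma splits_hom K L (f : {lrmorphism K -> L}) (E : {subfield K}) X :
  splits E X -> splits (linfun_ahom f @: E)%AS X.
Proof.
have fE c : f (emb K c) = emb L c by rewrite !embE rmorph_alg.
case=> al [be [abE [eA eB eC eD]]]; exists (f \o al), (f \o be); split=> [i|].
  have [aE bE] := abE i.
  split; last by have := memv_img (linfun f) bE; rewrite lfunE.
  by have := memv_img (linfun f) aE; rewrite lfunE.
by split; rewrite -fE /= ?eA ?eB ?eC ?eD !(rmorphD, rmorphM).
Qed.

(** The image of K splits the cubic, so it is all of L. *)
Lemma split_field_hom_bij K L (f : {lrmorphism K -> L}) X :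
  is_split_field K X -> is_split_field L X -> bijective f.
Proof.
move=> [sK _] [_ minL]; have full := minL _ (splits_hom f sK).
have surj y : exists x, f x == y.
  have : y \in (linfun f @: {:K})%VS by rewrite full memvf.
  by case/memv_imgP => x _ ->; exists x; rewrite lfunE.
exists (fun y => xchoose (surj y)) => [x|y].
  by apply: (fmorph_inj f); apply/eqP/(xchooseP (surj (f x))).
exact/eqP/(xchooseP (surj y)).
Qed.

Lemma split_field_bij K L (f : {lrmorphism K -> L}) X : bijective f ->
  is_split_field L X -> is_split_field K X.
Proof.
move=> [h fK hK] [[al [be [_ [eA eB eC eD]]]] minL].
have fE c : f (emb K c) = emb L c by rewrite !embE rmorph_alg.
split.
  exists (h \o al), (h \o be); split=> [i|]; first by rewrite !memvf.
  by split; apply: (can_inj fK);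
    rewrite fE ?eA ?eB ?eC ?eD /= !(rmorphD, rmorphM) /= !hK.
move=> E sE; have full := minL _ (splits_hom f sE).
apply/eqP; rewrite eqEsubv subvf; apply/subvP => x _.
have : f x \in (linfun f @: E)%VS by rewrite full memvf.
by case/memv_imgP => z zE; rewrite lfunE => /(can_inj fK) ->.
Qed.

(** Over a splitting field, having a zero over F is decided by which of the
   roots of the monic form lie in F. *)
Lemma zero_or_not K X : is_split_field K X -> dt X = 0 -> du X = 0 ->
  has_zero X \/ ~ has_zero X.
Proof.
move=> sK t0 u0; have [A0|A0] := eqVneq (dA X) 0.
  by left; exists 1, 0; rewrite oner_eq0; split=> //; rewrite /cubic A0; ring.
have [P [Q eqX]] := normal_monic three_neq0 A0 t0 u0.
have [/splits_cubic[r [_ eB eC eD]] _] := (is_split_field_dequiv K eqX).1 sK.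
suff : has_zero (Datum 1 0 P Q 0 0) \/ ~ has_zero (Datum 1 0 P Q 0 0).
  case=> h; [left | right]; first exact: dequiv_has_zero (dequiv_sym eqX) h.
  by move=> /(dequiv_has_zero eqX).
have ev x : (x - r 0) * (x - r 1) * (x - r 2%R)
    = x ^+ 3 + emb K 0 * x ^+ 2 + emb K P * x + emb K Q.
  by rewrite eB eC eD; ring.
have [/existsP[i /mem1_emb[c rc]]|] := boolP [exists i, r i \in 1%VS].
  left; exists c, 1; rewrite oner_eq0 orbT; split=> //; apply: (@emb_inj _ K).
  transitivity ((emb K c - r 0) * (emb K c - r 1) * (emb K c - r 2%R)).
    by rewrite ev /cubic /= !(rmorphD, rmorphM, rmorphXn, rmorph1, rmorph0); ring.
  by rewrite -rc rmorph0; case: (I3P i) => ->; ring.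
rewrite negb_exists => /forallP nr; right=> [[x [y [nz0 xy0]]]].
have y0 : y != 0.
  apply/eqP => y0; move: nz0 xy0; rewrite y0 eqxx orbF /cubic /= => x0 /eqP.
  by rewrite (_ : _ + _ = x ^+ 3) ?expf_eq0 ?(negbTE x0) //; ring.
have : (emb K (x / y) - r 0) * (emb K (x / y) - r 1) * (emb K (x / y) - r 2%R) = 0.
  rewrite ev -!(rmorphXn, rmorphM, rmorphD) /=.
  apply/eqP; rewrite fmorph_eq0; apply/eqP.
  transitivity (cubic (Datum 1 0 P Q 0 0) x y / y ^+ 3).
    by rewrite /cubic /=; field.
  by rewrite xy0 mul0r.
move/eqP; rewrite !mulf_eq0 !subr_eq0 -orbA => /or3P[] /eqP e;
  [have := nr 0 | have := nr 1 | have := nr 2%R]; by rewrite -e (emb_mem 1%AS).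
Qed.

(** If the cubic has a zero, K is generated by a square root. Otherwise take the
   monic form x^3 + P x + Q with roots r0, r1, r2 in K and let th = r0 - r1. It
   generates K, because r2^2 = - (th^2 + 4P)/3 and r2 = - Q / (r2^2 + P) express
   r2 by th, and r0 and r1 are combinations of th and r2. Finally th is a zero of
   X^6 + 6P X^4 + 9P^2 X^2 + 4P^3 + 27Q^2, whose zeros, in K as in L, are the six
   differences of roots. *)
Lemma split_field_hom K L X :
  discD X != 0 -> is_split_field K X -> is_split_field L X ->
  exists f : {lrmorphism K -> L}, True.
Proof.
move=> dX sK sL.
(* With the marked vector 0 the cubic can be put in normal form. *)
pose X0 := Datum (dA X) (dB X) (dC X) (dD X) 0 0.
have {}dX : discD X0 != 0 := dX.
have {}sK : is_split_field K X0 := sK.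
have {}sL : is_split_field L X0 := sL.
have [hz|nz0] := zero_or_not sK erefl erefl.
  have [A A0 eqX] := normal_has_zero two_neq0 three_neq0 dX erefl erefl hz.
  have sqrt M : is_split_field M X0 ->
      exists s : M, s ^+ 2 = emb M (- (A * 1)) /\ <<1; s>>%VS = {:M}%VS.
    move=> /(is_split_field_dequiv M eqX).
    by move/split_field_quadratic; apply=> //; exact: oner_neq0.
  have [x [x2 genK]] := sqrt K sK; have [y [y2 _]] := sqrt L sL.
  apply: (@root_ext_hom K L x ('X^2 - (- (A * 1))%:P) [:: y; - y] genK).
    rewrite rmorphB /= map_polyXn map_polyC; apply/rootP; rewrite !hornerE x2; ring.
  rewrite rmorphB /= map_polyXn map_polyC /= -y2 !big_cons big_nil.
  by rewrite polyCN polyC_exp; ring.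
have [P [Q eqX]] := normal_monic three_neq0 (no_zero_dA nz0) erefl erefl.
have Q0 : Q != 0.
  apply/eqP => Q0; apply: nz0; apply: dequiv_has_zero (dequiv_sym eqX) _.
  by exists 0, 1; rewrite oner_eq0 orbT; split=> //; rewrite /cubic Q0 /=; ring.
have [/splits_cubic[r [_ eB eC eD]] minK] := (is_split_field_dequiv K eqX).1 sK.
have [/splits_cubic[r' [_ eB' eC' eD']] _] := (is_split_field_dequiv L eqX).1 sL.
move: (r' 0) (r' 1) (r' 2%R) eB' eC' eD' => s0 s1 s2 eB' eC' eD'.
have s2E : s2 = - s0 - s1.
  by transitivity (- emb L 0 - s0 - s1); [rewrite eB'; ring | rewrite rmorph0; ring].
have r2E : r 2%R = - r 0 - r 1.
  by transitivity (- emb K 0 - r 0 - r 1); [rewrite eB; ring | rewrite rmorph0; ring].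
have n2 := two_neq0K K two_neq0; have n3 := three_neq0K K three_neq0.
pose R : {poly F} := 'X^6 + (6 * P) *: 'X^4 + (9 * P ^+ 2) *: 'X^2
  + (4 * P ^+ 3 + 27 * Q ^+ 2)%:P.
have RM M : map_poly (emb M) R = 'X^6 + (6 * emb M P) *: 'X^4
    + (9 * emb M P ^+ 2) *: 'X^2 + (4 * emb M P ^+ 3 + 27 * emb M Q ^+ 2)%:P.
  rewrite /R 3!rmorphD /= !map_polyZ !map_polyXn !map_polyC /=.
  by congr (_ + _ *: _ + _ *: _ + _%:P);
    rewrite !(rmorphD, rmorphM, rmorphXn, rmorph_nat); ring.
apply: (@root_ext_hom K L (r 0 - r 1) R
  [:: s0 - s1; s1 - s0; s0 - s2; s2 - s0; s1 - s2; s2 - s1]).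
- apply: (minK <<1; (r 0 - r 1)%R>>%AS); apply/splits_cubic.
  set E := <<1; _>>%AS; have tE : r 0 - r 1 \in E by rewrite memv_adjoin.
  have nE n : n%:R \in E by rewrite rpredMn ?mem1v.
  have r22 : r 2%R ^+ 2 = - ((r 0 - r 1) ^+ 2 + 4 * emb K P) / 3.
    by rewrite eC r2E; field.
  have PQ : r 2%R * (r 2%R ^+ 2 + emb K P) = - emb K Q by rewrite eC eD r2E; ring.
  have wP : r 2%R ^+ 2 + emb K P != 0.
    apply: contraNneq Q0 => w0; move/eqP: PQ; rewrite w0 mulr0 eq_sym oppr_eq0.
    by rewrite fmorph_eq0.
  have r2wE : r 2%R ^+ 2 \in E.
    rewrite r22; apply: rpred_div; last exact: (nE 3%N).
    rewrite rpredN; apply: rpredD; first by rewrite rpredX.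
    by apply: rpredM; [exact: (nE 4%N) | apply: emb_mem].
  have r2E' : r 2%R \in E.
    have -> : r 2%R = - emb K Q / (r 2%R ^+ 2 + emb K P).
      by apply: (canRL (mulfK wP)).
    by apply: rpred_div; rewrite ?rpredN ?emb_mem //; apply: rpredD; rewrite ?emb_mem.
  exists r; split=> // i; case: (I3P i) => -> //.
    have -> : r 0 = ((r 0 - r 1) - r 2%R) / 2 by rewrite r2E; field.
    by apply: rpred_div; [apply: rpredB | apply: (nE 2%N)].
  have -> : r 1 = (- (r 0 - r 1) - r 2%R) / 2 by rewrite r2E; field.
  by apply: rpred_div; [apply: rpredB; rewrite ?rpredN | apply: (nE 2%N)].
- by apply/rootP; rewrite RM !(hornerD, hornerZ, hornerXn, hornerC) eC eD r2E; ring.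
rewrite RM -!mul_polyC eC' eD' s2E !big_cons big_nil.
by rewrite !(polyCD, polyCN, polyC_exp, polyCM, polyC_natr); ring.
Qed.

Lemma split_field_unique K L X : discD X != 0 -> is_split_field K X ->
  is_split_field L X -> ext_equiv K L.
Proof.
move=> dX sK sL; have [f _] := split_field_hom dX sK sL.
by exists f; apply: split_field_hom_bij sK sL.
Qed.

End SplittingFieldUnique.

(** * Galois extensions with group in S_3 *)

(** The nontrivial element of a normal subgroup of order 2 is central. *)
Lemma S3_no_normal2 (M : {group 'S_3}) : (M <| [set: 'S_3])%g -> #|M| != 2%N.
Proof.
case/andP => _ /subsetP nM; apply/negP => /eqP M2.
have [x xM x1] : exists2 x, x \in M & x != 1%g.
  by apply/trivgPn; rewrite trivg_card1 M2.
have cx t : (x * t = t * x)%g.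
  have := nM t (in_setT _); rewrite inE => /subsetP/(_ (x ^ t)%g).
  rewrite mem_conjg conjgK => /(_ xM) xtM.
  have : (M :\ 1%g) = [set x].
    apply/eqP; rewrite eq_sym eqEcard sub1set !inE x1 xM cards1.
    have := cardsD1 1%g M; rewrite M2 group1 add1n => /eqP.
    by rewrite eqSS => /eqP <-.
  move/setP/(_ (x ^ t)%g); rewrite !inE xtM andbT conjg_eq1 x1 => /esym/eqP xt.
  by rewrite conjgC xt.
have /permP e1 := cx (tperm 0%R 1%R); have /permP e2 := cx (tperm 0%R 2%R).
move: x1 (e1 0) (e2 0) (e1 1) (e2 1) {xM cx}.
by elim/perm3_cases: x {e1 e2}; rewrite ?eqxx // => _;
  rewrite !permM ?permE /=; rewrite ?permE.
Qed.

Lemma dvdn6 n : (n %| 6)%N -> n \in [:: 1; 2; 3; 6]%N.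
Proof. by rewrite dvdn_divisors. Qed.

Section GaloisCubics.
Variables (F : fieldType) (K : splittingFieldType F).
Hypotheses (two_neq0 : (2 : F) != 0) (three_neq0 : (3 : F) != 0).
Hypothesis galK : galois 1 {:K}.

(** The minimal polynomial of al, whose roots are distinct and lie in K because
   K is Galois over F. *)
Lemma galois_cubic (al : K) : adjoin_degree 1%AS al = 3%N ->
  exists X (r : 'I_3 -> K),
    [/\ dt X = 0 /\ du X = 0, discD X != 0, splits {:K}%AS X,
        (forall E : {subfield K}, splits E X -> forall i, r i \in E)
      & (exists i, r i = al) /\ minPoly 1%AS al = \prod_i ('X - (r i)%:P)].
Proof.
move=> deg3; have [rs urs mE] : exists2 rs : seq K, uniq rs &
    minPoly 1%AS al = \prod_(b <- rs) ('X - b%:P).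
  have /(galois_factors (sub1v _))/(_ al (memvf al))[gs [_ ugs ->]] := galK.
  by exists [seq x al | x : gal_of _ <- gs].
have szr : size rs = 3%N.
  have := congr1 (fun p : {poly K} => size p) mE.
  by rewrite /= size_prod_XsubC size_minPoly deg3 => - [].
pose r (i : 'I_3) := rs`_i.
have pE : minPoly 1%AS al = \prod_i ('X - (r i)%:P).
  by rewrite mE (big_nth 0) szr big_mkord.
have pE3 : minPoly 1%AS al = 'X^3 - (r 0 + r 1 + r 2%R) *: 'X^2 +
    (r 0 * r 1 + r 0 * r 2%R + r 1 * r 2%R) *: 'X - (r 0 * r 1 * r 2%R)%:P.
  by rewrite pE big_I3 /= -!mul_polyC !(polyCD, polyCM); ring.
have coefF i : exists c, (minPoly 1%AS al)`_i = emb K c.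
  by apply/mem1_emb/(polyOverP (minPolyOver _ _)).
have [B eB] := coefF 2%N; have [C eC] := coefF 1%N; have [D eD] := coefF 0%N.
rewrite pE3 !(coefD, coefN, coefZ, coefXn, coefX, coefC) /= in eB eC eD.
have {}eB : emb K B = - (r 0 + r 1 + r 2%R) by rewrite -eB; ring.
have {}eC : emb K C = r 0 * r 1 + r 0 * r 2%R + r 1 * r 2%R by rewrite -eC; ring.
have {}eD : emb K D = - (r 0 * r 1 * r 2%R) by rewrite -eD; ring.
have rneq i j : i != j -> r i != r j.
  by move=> ij; rewrite /r nth_uniq ?szr.
exists (Datum 1 B C D 0 0), r; split=> //.
- rewrite -(fmorph_eq0 (emb K)); suff -> : emb K (discD (Datum 1 B C D 0 0)) =
     ((r 0 - r 1) * (r 0 - r 2%R) * (r 1 - r 2%R)) ^+ 2.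
    by rewrite expf_neq0 // !mulf_neq0 ?subr_eq0 ?rneq.
  rewrite /discD /disc /=.
  rewrite !(rmorphB, rmorphD, rmorphM, rmorphXn, rmorph1, rmorph_nat) /=.
  by rewrite eB eC eD; ring.
- by apply/splits_cubic; exists r; split=> // i; rewrite memvf.
- move=> E /splits_cubic[r' [r'E eB' eC' eD']] i.
  apply: (splits_root r'E eB' eC' eD'); rewrite eB eC eD; case: (I3P i) => ->; ring.
split=> //; have : root (minPoly 1%AS al) al := root_minPoly _ _.
by rewrite pE big_I3 /= !rootM !root_XsubC -orbA => /or3P[]/eqP ->; eexists.
Qed.

(** In degree 3 any element outside F generates K. In degree 6 let al generate the
   fixed field of an involution; if its minimal polynomial split over a proper
   subfield, this would be F(al), which would be normal over F although its Galois
   group is a subgroup of order 2 of S_3. *)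
Lemma exists_split_zero_tau (H : {group 'S_3}) : 'Gal({:K} / 1) \isog H ->
  exists X, [/\ dt X = 0 /\ du X = 0, discD X != 0 & is_split_field K X].
Proof.
move=> isoH; have dimK : \dim {:K} = #|'Gal({:K} / 1)%g|.
  by rewrite -(galois_dim galK) dimv1 divn1.
have cardH : #|'Gal({:K} / 1)%g| = #|H| := card_isog isoH.
have dim6 : (\dim {:K} %| 6)%N.
  rewrite dimK cardH; have := cardSg (subsetT H).
  by rewrite cardsT card_Sn.
have [le2|gt2] := leqP (\dim {:K}) 2.
  have [A A0 sK] :=
    exists_split_quadratic two_neq0 three_neq0 0 0 (oner_neq0 F) le2.
  exists (Datum A 0 1 0 0 0); split=> //.
  by rewrite /discD /disc /= (_ : _ - _ = -4 * A); [nz | ring].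
have dim36 : \dim {:K} = 3%N \/ \dim {:K} = 6%N.
  by move: gt2; have := dvdn6 dim6; rewrite !inE => /or4P[] /eqP-> //; [left | right].
have deg_proper x (V : {subfield K}) : \dim V = 3%N -> x \in V -> x \notin 1%VS ->
    adjoin_degree 1%AS x = 3%N.
  move=> dimV xV x1; have sub : (<<1; x>>%AS <= V)%VS by rewrite sub_adjoin1v.
  have := field_dimS sub; rewrite dim_Fadjoin dimv1 muln1 dimV.
  have : adjoin_degree 1%AS x != 1%N by rewrite adjoin_deg_eq1.
  by move=> n1 /(prime_nt_dvdP (isT : prime 3) n1).
have ex_gen (V : {subfield K}) : \dim V = 3%N -> exists2 x, x \in V & x \notin 1%VS.
  move=> dimV; have : ~~ (V <= 1)%VS.
    by apply/negP => /dimvS; rewrite dimV dimv1.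
  by case/subvPn => x; exists x.
case: dim36 => dimK'.
  have [al _ al1] := ex_gen {:K}%AS dimK'.
  have deg3 := deg_proper _ _ dimK' (memvf al) al1.
  have [X [r [tX dX sX rE [[i ri] _]]]] := galois_cubic deg3.
  exists X; split=> //; split=> // E sE; apply/eqP; rewrite eqEdim subvf /=.
  have alE : al \in E by rewrite -ri rE.
  have := dimvS (_ : (<<1; al>>%AS <= E)%VS); rewrite sub_adjoin1v => /(_ alE).
  by rewrite dim_Fadjoin dimv1 muln1 deg3 dimK'.
have [g gG og] : exists2 g, g \in 'Gal({:K} / 1)%g & #[g]%g = 2%N.
  have [|g gG og] := @Cauchy _ 2 ('Gal({:K} / 1))%G isT; last by exists g.
  by rewrite -dimK dimK'.
pose V := fixedField <[g]>%g.
have dimV : \dim V = 3%N.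
  have := dim_fixedField <[g]>%G; rewrite -orderE og => d2.
  have := dim_sup_field (fixedField_bound <[g]>%G); rewrite -d2 dimK' -/V.
  by move/eqP; rewrite -[6%N]/(2 * 3)%N eqn_pmul2l // => /eqP.
have [al alV al1] := ex_gen _ dimV.
have deg3 := deg_proper _ _ dimV alV al1.
have [X [r [tX dX sX rE [[i ri] mE]]]] := galois_cubic deg3.
exists X; split=> //; split=> // E sE; apply/eqP; rewrite eqEdim subvf /= dimK'.
have alE : al \in E by rewrite -ri rE.
have leE : (<<1; al>>%AS <= E)%VS by rewrite sub_adjoin1v.
have := field_dimS leE; have := @field_dimS _ _ E {:K}%AS (subvf _).
rewrite dim_Fadjoin dimv1 muln1 deg3 dimK' => dvd6 dvd3.
have : \dim E = 3%N \/ \dim E = 6%N.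
  by move: dvd3; have := dvdn6 dvd6; rewrite !inE => /or4P[] /eqP-> //; [left | right].
case=> [dimE|->] //.
have EE : (<<1; al>>%AS = E :> {vspace K})%VS.
  by apply/eqP; rewrite eqEdim leE dim_Fadjoin dimv1 muln1 deg3 dimE.
have normE : normalField 1 E.
  apply/(splitting_normalField (sub1v E)); exists (minPoly 1%AS al).
    exact: minPolyOver.
  exists [seq r i | i <- enum 'I_3].
    by rewrite mE big_map big_enum /= eqpxx.
  apply/eqP; rewrite eqEsubv; apply/andP; split.
    by apply/Fadjoin_seqP; split; [exact: sub1v | move=> _ /mapP[j _ ->]; apply: rE].
  rewrite -EE sub_adjoin1v -ri; apply: seqv_sub_adjoin.
  by apply: map_f; rewrite mem_enum.
have nG : ('Gal({:K} / E) <| 'Gal({:K} / 1))%g.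
  apply: normalField_normal => //; by rewrite sub1v subvf.
have card2 : #|'Gal({:K} / E)%g| = 2%N.
  have galE : galois E {:K} by apply: galoisS galK; rewrite sub1v subvf.
  by rewrite -(galois_dim galE) dimK' dimE.
have /isogP[f injf fG] := isoH.
have HT : H = [set: 'S_3]%G.
  apply/val_inj/eqP; rewrite eqEcard subsetT /= -cardH -dimK dimK'.
  by rewrite cardsT card_Sn.
have := @S3_no_normal2 (f @* 'Gal({:K} / E))%G.
rewrite -[[set: _]]/(val [set: 'S_3]%G) -HT /= -fG morphim_normal // => /(_ isT).
by rewrite /= (card_injm injf (normal_sub nG)) card2.
Qed.

End GaloisCubics.

(** * Associativity *)

Section Associativity.
Variable K : fieldType.
Hypotheses (two_neq0 : (2 : K) != 0) (three_neq0 : (3 : K) != 0).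

(** The coordinates of the associators of (e0, e0, e1) and (e0, e1, e1); by
   commutativity the second coordinate for (e0, e1, e1) repeats the first one
   for (e0, e0, e1). *)
Definition assoc_struct (n : structure K) :=
  [/\ n 0 0 1 * n 1 1 0 = n 0 1 0 * n 0 1 1,
      n 0 0 0 * n 0 1 1 + n 0 0 1 * n 1 1 1 = n 0 1 0 * n 0 0 1 + n 0 1 1 ^+ 2
    & n 0 1 0 ^+ 2 + n 0 1 1 * n 1 1 0 = n 1 1 0 * n 0 0 0 + n 1 1 1 * n 0 1 0].

(** In a commutative algebra of dimension 2 the associator of x, y, z is the area
   of x and z times a linear function of y. *)
Lemma assoc_structP (W : vectType K) (e : 'I_2 -> W) (co : 'I_2 -> W -> K)
    (M : W -> W -> W) n :
  (forall i j, co i (e j) = (i == j)%:R) ->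
  (forall v w, (forall i, co i v = co i w) -> v = w) ->
  represents co M n -> associative M <-> assoc_struct n.
Proof.
move=> co_e co_inj [ME nC].
have E v w k :
    co k (M v w) = co 0 v * co 0 w * n 0 0 k + co 0 v * co 1 w * n 0 1 k
                   + (co 1 v * co 0 w * n 0 1 k + co 1 v * co 1 w * n 1 1 k).
  by rewrite ME !sum_I2 (nC 1 0).
split=> [MA|[e1 e2 e3] x y z].
  have A1 := congr1 (co 0) (MA (e 0) (e 0) (e 1)).
  have A2 := congr1 (co 1) (MA (e 0) (e 0) (e 1)).
  have A3 := congr1 (co 0) (MA (e 0) (e 1) (e 1)).
  rewrite !E !co_e /= !(mul0r, mulr0, mul1r, mulr1, addr0, add0r) in A1 A2 A3.
  split; apply/eqP; rewrite -subr_eq0; apply/eqP.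
  - by move/eqP: A1; rewrite -subr_eq0 -oppr_eq0 => /eqP <-; ring.
  - by move/eqP: A2; rewrite -subr_eq0 -oppr_eq0 => /eqP <-; ring.
  - by move/eqP: A3; rewrite -subr_eq0 -oppr_eq0 => /eqP <-; ring.
apply: co_inj => k; rewrite !E; apply/eqP; rewrite -subr_eq0; apply/eqP.
case: (ord2P k) => ->.
  transitivity ((co 0 x * co 1 z - co 1 x * co 0 z) *
    ((n 0 1 0 * n 0 1 1 - n 0 0 1 * n 1 1 0) * co 0 y
     + ((n 1 1 0 * n 0 0 0 + n 1 1 1 * n 0 1 0)
        - (n 0 1 0 ^+ 2 + n 0 1 1 * n 1 1 0)) * co 1 y)); first by ring.
  by rewrite e1 e3; ring.
transitivity ((co 0 x * co 1 z - co 1 x * co 0 z) *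
    (((n 0 1 0 * n 0 0 1 + n 0 1 1 ^+ 2)
      - (n 0 0 0 * n 0 1 1 + n 0 0 1 * n 1 1 1)) * co 0 y
     + (n 0 0 1 * n 1 1 0 - n 0 1 0 * n 0 1 1) * co 1 y)); first by ring.
by rewrite e1 e2; ring.
Qed.

Lemma assoc_struct_of n :
  assoc_struct n <-> assoc_struct (struct_of (struct_datum n)).
Proof.
rewrite /assoc_struct /struct_of /=.
have -> : - - n 0 0 1 = n 0 0 1 by rewrite opprK.
have -> : - (n 0 0 0 - 2 * n 0 1 1 + - (n 0 0 0 + n 0 1 1)) / 3 = n 0 1 1 by field.
have -> : (2 * n 0 1 0 - n 1 1 1 + (n 1 1 1 + n 0 1 0)) / 3 = n 0 1 0 by field.
have -> : - - (n 0 0 0 + n 0 1 1) - n 0 1 1 = n 0 0 0 by ring.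
by have -> : n 1 1 1 + n 0 1 0 - n 0 1 0 = n 1 1 1 by ring.
Qed.

Lemma assoc_datum A : assoc_struct (struct_of (Datum A 0 (1 / 2) 0 1 0)).
Proof. by split; rewrite /struct_of /=; field; nz. Qed.

(** With tau = 0 associativity says BC = 9AD, B^2 = 3AC and C^2 = 3BD, so the
   Hessian of the cubic vanishes identically. *)
Lemma assoc_tau X : discD X != 0 -> dt X = 0 -> du X = 0 ->
  ~ assoc_struct (struct_of X).
Proof.
case: X => A B C D t u dX /= t0 u0; rewrite t0 u0 {t0 u0} => [] [/= e1 e2 e3].
have f1 : B * C = 9 * (A * D).
  apply/eqP; rewrite -subr_eq0; apply/eqP.
  transitivity (9 * (- A * D - (C + 0) / 3 * (- (B + 0) / 3))); first by field.
  by rewrite e1 subrr mulr0.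
have f2 : B ^+ 2 = 3 * (A * C).
  apply: (mulfI two_neq0); apply/eqP; rewrite -subr_eq0 -oppr_eq0; apply/eqP.
  transitivity (9 * (((- 0 - - (B + 0) / 3) * (- (B + 0) / 3)
                      + - A * (0 - (C + 0) / 3))
                     - ((C + 0) / 3 * - A + (- (B + 0) / 3) ^+ 2))).
    by field.
  by rewrite e2 subrr mulr0.
have f3 : C ^+ 2 = 3 * (B * D).
  apply: (mulfI two_neq0); apply/eqP; rewrite -subr_eq0; apply/eqP.
  transitivity (9 * ((((C + 0) / 3) ^+ 2 + - (B + 0) / 3 * D)
                     - (D * (- 0 - - (B + 0) / 3)
                        + (0 - (C + 0) / 3) * ((C + 0) / 3)))).
    by field.
  by rewrite e3 subrr mulr0.
have : discD (Datum A B C D 0 0) != 0 by [].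
rewrite /discD /disc /=; case/eqP.
transitivity (2 * (9 * (A * D)) * (B * C) + (B * C) ^+ 2
   - 4 / 3 * (3 * (A * C)) * C ^+ 2 - 4 / 3 * B ^+ 2 * (3 * (B * D))
  
   - 1 / 3 * (9 * (A * D)) ^+ 2); first by field.
by rewrite -f1 -f2 -f3; field.
Qed.

(** Every datum with nonzero tau is equivalent to one with tau = (1, 0) and with A
   or B equal to zero. *)
Lemma assoc_normal A B C D : discD (Datum A B C D 1 0) != 0 -> A = 0 \/ B = 0 ->
  assoc_struct (struct_of (Datum A B C D 1 0)) -> [/\ A != 0, B = 0, C = 1 / 2 & D = 0].
Proof.
move=> dX AB [/= e1 e2 e3].
have [A0|A0] := eqVneq A 0.
  have /eqP : 2 * B ^+ 2 = 0.
    transitivity (- (9 * (((- 0 - - (B + 0) / 3) * (- (B + 0) / 3)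
                           + - A * (1 - (C + 1) / 3))
                          - ((C + 1) / 3 * - A + (- (B + 0) / 3) ^+ 2)))).
      by rewrite A0; field.
    by rewrite e2 subrr mulr0 oppr0.
  rewrite mulf_eq0 (negbTE two_neq0) expf_eq0 /= => /eqP B0.
  by move: dX; rewrite /discD /disc /= A0 B0; case/eqP; ring.
case: AB => [AE|B0]; first by rewrite AE eqxx in A0.
have D0 : D = 0.
  apply: (mulfI A0); rewrite mulr0.
  transitivity (- (- A * D - (C + 1) / 3 * (- (B + 0) / 3))).
    by rewrite B0; field.
  by rewrite e1 subrr oppr0.
split=> //; apply: (mulfI A0); apply: (mulfI two_neq0).
apply/eqP; rewrite -subr_eq0; apply/eqP.
transitivity (3 * (((- 0 - - (B + 0) / 3) * (- (B + 0) / 3)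
                    + - A * (1 - (C + 1) / 3))
                   - ((C + 1) / 3 * - A + (- (B + 0) / 3) ^+ 2))).
  by rewrite B0; field; nz.
by rewrite e2 subrr mulr0.
Qed.

End Associativity.

(** * Extension of the base field *)

Definition map_datum (R S : Type) (f : R -> S) (X : datum R) : datum S :=
  Datum (f (dA X)) (f (dB X)) (f (dC X)) (f (dD X)) (f (dt X)) (f (du X)).

Section MapDatum.
Variables (F K : fieldType) (f : {rmorphism F -> K}).

Lemma struct_datum_map (n : structure F) :
  struct_datum (fun i j k => f (n i j k)) = map_datum f (struct_datum n).
Proof.
by congr Datum; rewrite /= !(rmorph_nat, rmorphB, rmorphD, rmorphN, rmorphM);
  ring.
Qed.

Lemma discD_map X : discD (map_datum f X) = f (discD X).
Proof.
rewrite /discD /disc /= !(rmorphB, rmorphD, rmorphM, rmorphXn, rmorph_nat).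
by ring.
Qed.

Lemma nuD_map X : nuD (map_datum f X) = (f (nuD X).1, f (nuD X).2).
Proof.
rewrite /nuD /= !fmorph_div -!discD_map; congr (_ / _, _ / _).
  rewrite /p3D /cubic /= !(rmorphN, rmorphD, rmorphM, rmorphXn, rmorph_nat).
  by ring.
rewrite /p2D /= !(rmorphB, rmorphD, rmorphM, rmorphXn, rmorph_nat).
by ring.
Qed.

Lemma Cardano_map p : Cardano (f p.1, f p.2) = Cardano p.
Proof.
rewrite /Cardano /= -[RHS](fmorph_eq0 f).
by congr (_ == 0); rewrite !(rmorphD, rmorphM, rmorphXn, rmorph_nat); ring.
Qed.

End MapDatum.

(** * The fundamental cubic and the invariants in a basis of the plane *)

Lemma mderiv_var (R : comNzRingType) n (i j : 'I_n) :
  ('X_j : {mpoly R[n]})^`M(i) = (i == j)%:R.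
Proof.
rewrite mderivX mnm1E eq_sym; case: eqVneq => [->|_]; last by rewrite scale0r.
have -> : (U_(j) - U_(j) = 0)%MM by apply/mnmP => k; rewrite mnmBE mnm0E subnn.
by rewrite scale1r mpolyX0.
Qed.

Lemma meval_binary_cubic (R : fieldType) (A B C D : R) (x : 'I_2 -> R) :
  (binary_cubic A B C D).@[x] = cubic (Datum A B C D 0 0) (x 0) (x 1).
Proof.
rewrite /binary_cubic !(mevalD, mevalZ, mevalM, mevalXU, rmorphXn) /=.
by rewrite /cubic /=; ring.
Qed.

Lemma meval_hessian (R : fieldType) (A B C D : R) (x : 'I_2 -> R) :
  (hessian (binary_cubic A B C D)).@[x] =
  (6 * A * x 0 + 2 * B * x 1) * (2 * C * x 0 + 6 * D * x 1)
    - (2 * B * x 0 + 2 * C * x 1) ^+ 2.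
Proof.
have X0 : ('X_0 : {mpoly R[2]})^`M(0) = 1 by rewrite mderiv_var.
have X01 : ('X_0 : {mpoly R[2]})^`M(1) = 0 by rewrite mderiv_var.
have X1 : ('X_1 : {mpoly R[2]})^`M(1) = 1 by rewrite mderiv_var.
have X10 : ('X_1 : {mpoly R[2]})^`M(0) = 0 by rewrite mderiv_var.
have cE (c : R) (p : {mpoly R[2]}) : c *: p = c%:MP * p by rewrite mul_mpolyC.
have D0 : (binary_cubic A B C D)^`M(0) =
    (3 * A) *: ('X_0 * 'X_0) + (2 * B) *: ('X_0 * 'X_1) + C *: ('X_1 * 'X_1).
  rewrite /binary_cubic !mderivD !mderivZ !mderivM X0 X10 !cE.
  by rewrite !mpolyCM !mpolyC_nat; ring.
have D1 : (binary_cubic A B C D)^`M(1) =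
    B *: ('X_0 * 'X_0) + (2 * C) *: ('X_0 * 'X_1) + (3 * D) *: ('X_1 * 'X_1).
  rewrite /binary_cubic !mderivD !mderivZ !mderivM X1 X01 !cE.
  by rewrite !mpolyCM !mpolyC_nat; ring.
rewrite /hessian D0 D1 !mderivD !mderivZ !mderivM X0 X1 X01 X10.
rewrite !(mevalB, mevalD, mevalZ, mevalM, mevalXU, meval1, meval0).
by ring.
Qed.

Section Plane.
Variables (F : fieldType) (V : vectType F) (e : 2.-tuple V).
Hypotheses (two_neq0 : (2 : F) != 0) (three_neq0 : (3 : F) != 0).
Hypothesis e_basis : basis_of {:V} e.
Implicit Types m : {bilinear V -> V -> V}.

Let bas (i : 'I_2) : V := e`_i.
Let co (i : 'I_2) (v : V) : F := coord e i v.

Let co_lin i : linear_for *%R (co i).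
Proof. by move=> a v w; rewrite /co linearP. Qed.

Let co_e i j : co i (bas j) = (i == j)%:R.
Proof. by rewrite /co /bas coord_free ?(basis_free e_basis) // eq_sym. Qed.

Let coE v : v = co 0 v *: bas 0 + co 1 v *: bas 1.
Proof. by rewrite {1}(coord_basis e_basis (memvf v)) sum_I2. Qed.

Definition datum_of m : datum F := struct_datum (coef e m).

Lemma represents_coef m : commutative m -> represents co m (coef e m).
Proof.
by move=> mC; split=> [v w k | i j k]; [apply: bilinear_coordE | rewrite /coef mC].
Qed.

Lemma nu_datum m : nu e m = nuD (datum_of m).
Proof.
rewrite /nu /nuD /p3_tilde /p2_tilde /fund_cubic meval_binary_cubic.
by rewrite meval_hessian.
Qed.

Lemma generic_datum m : generic e m <-> commutative m /\ discD (datum_of m) != 0.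
Proof. by []. Qed.

Lemma datum_of_onto X : exists m, commutative m /\ datum_of m = X.
Proof.
exists (product bas co_lin (struct_of X)); split.
  apply: productC => // i j k; rewrite /struct_of.
  by case: (ord2P i) => ->; case: (ord2P j) => ->.
rewrite -[RHS](struct_ofK three_neq0 X) /datum_of.
have nE n i j k : coef e (product bas co_lin n) i j k = n i j k.
  rewrite -[LHS]/(co k (product bas co_lin n (bas i) (bas j))).
  rewrite (co_product co_lin co_e).
  rewrite !sum_I2 !co_e; case: (ord2P i) => ->; case: (ord2P j) => -> /=;
    by rewrite ?(mul0r, mulr0, mul1r, mulr1, addr0, add0r).
by rewrite /struct_datum !nE.
Qed.

Lemma same_orbit_datum m1 m2 : generic e m1 -> generic e m2 ->
  same_orbit m1 m2 <-> dequiv (datum_of m1) (datum_of m2).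
Proof.
move=> [C1 _] [C2 _]; apply: (same_orbit_dat co_lin co_e coE three_neq0).
  exact: represents_coef.
exact: represents_coef.
Qed.

Lemma split_field_datum m (K : fieldExtType F) :
  is_splitting_field (fund_cubic e m) K <-> is_split_field K (datum_of m).
Proof. exact: (is_split_fieldP K two_neq0 (datum_of m)). Qed.

Lemma associative_datum m : generic e m -> associative m <-> assoc_struct (coef e m).
Proof.
move=> [mC _]; apply: (@assoc_structP _ _ bas co) => //; first exact: (co_inj coE).
exact: represents_coef.
Qed.

Lemma assoc_orbit m1 m2 : same_orbit m1 m2 -> associative m1 -> associative m2.
Proof.
move=> [g kg eqm] m1A u v w; rewrite -!eqm /Defs.act !(lker0_lfunK kg).
by rewrite m1A.
Qed.

Lemma associative_dequiv m X : generic e m -> dequiv (datum_of m) X ->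
  associative m <-> assoc_struct (struct_of X).
Proof.
move=> gm eqX; have [m' [m'C m'X]] := datum_of_onto X.
have gm' : generic e m'.
  split=> //; rewrite -[Disc e m']/(discD (datum_of m')) m'X -(dequiv_disc eqX).
  by case: gm.
have o12 : same_orbit m m' by apply/same_orbit_datum; rewrite ?m'X.
have o21 : same_orbit m' m.
  by apply/same_orbit_datum; rewrite ?m'X //; apply: dequiv_sym.
have assocX : associative m' <-> assoc_struct (struct_of X).
  rewrite -m'X; apply: iff_trans (associative_datum gm') _.
  exact: assoc_struct_of three_neq0 _.
by split=> [/(assoc_orbit o12)/assocX|/assocX/(assoc_orbit o21)].
Qed.

Lemma represents_extend (K : fieldExtType F) m : commutative m ->
  represents (fun k (v : 'rV[K]_2) => v 0 k) (@extend_scalars F V e K m)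
    (fun i j k => emb K (coef e m i j k)).
Proof.
move=> mC; split=> [v w k|i j k]; last by rewrite /coef mC.
rewrite /extend_scalars summxE; apply: eq_bigr => i _; rewrite summxE.
by apply: eq_bigr => j _; rewrite !mxE embE.
Qed.

Lemma aut_isog_extend (K : fieldExtType F) m (gT : finGroupType) (G : {group gT}) :
  commutative m -> stab_isog (map_datum (emb K) (datum_of m)) G ->
  aut_isog (@extend_scalars F V e K m) G.
Proof.
move=> mC; rewrite /datum_of -struct_datum_map => sG.
have x_lin i : linear_for *%R (fun v : 'rV[K]_2 => v 0 i).
  by move=> a v w; rewrite !mxE.
have x_e i j : (delta_mx 0 j : 'rV[K]_2) 0 i = (i == j)%:R by rewrite !mxE.
have xE (v : 'rV[K]_2) : v = v 0 0 *: delta_mx 0 0 + v 0 1 *: delta_mx 0 1.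
  apply/rowP => i; rewrite !mxE.
  by case: (ord2P i) => -> /=; rewrite ?mulr1 ?mulr0 ?addr0 ?add0r.
exact: (aut_isog_dat x_lin x_e xE (three_neq0K K three_neq0)
  (represents_extend K mC) sG).
Qed.

End Plane.

(** * The classification *)

Section Classification.
Variables (F : fieldType) (V : vectType F) (e : 2.-tuple V).
Hypotheses (two_neq0 : (2 : F) != 0) (three_neq0 : (3 : F) != 0).
Hypothesis e_basis : basis_of {:V} e.
Implicit Types m : {bilinear V -> V -> V}.

Local Notation D := (datum_of e).

Lemma realize X : discD X != 0 ->
  exists m, [/\ generic e m, nu e m = nuD X & datum_of e m = X].
Proof.
move=> dX; have [m [mC mX]] := datum_of_onto three_neq0 e_basis X.
exists m; split=> //; last by rewrite nu_datum mX.
by split=> //; rewrite -[Disc e m]/(discD (D m)) mX.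
Qed.

Lemma nu_orbit m1 m2 : generic e m1 -> generic e m2 -> same_orbit m1 m2 ->
  nu e m1 = nu e m2.
Proof.
move=> g1 g2 /(same_orbit_datum three_neq0 e_basis g1 g2) /dequiv_nu.
by rewrite !nu_datum.
Qed.

Lemma noncardano_orbit m1 m2 : generic e m1 -> generic e m2 ->
  ~~ Cardano (nu e m1) -> nu e m1 = nu e m2 -> same_orbit m1 m2.
Proof.
move=> g1 g2; have [_ d1] := (generic_datum e m1).1 g1.
have [_ d2] := (generic_datum e m2).1 g2.
rewrite !nu_datum => nC eq_nu; apply/(same_orbit_datum three_neq0 e_basis g1 g2).
apply: dequiv_trans (normal_noncardano two_neq0 three_neq0 d1 nC) _.
rewrite eq_nu; apply/dequiv_sym/normal_noncardano => //.
by rewrite -eq_nu.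
Qed.

Lemma midcoef_neq0 (X : datum F) :
  discD X != 0 -> Cardano (nuD X) -> nuD X <> (0, 0) -> midcoef (nuD X) != 0.
Proof.
move=> dX cX nz0; have [A A0 eqX] := normal_cardano two_neq0 three_neq0 dX cX nz0.
move: dX; rewrite (dequiv_disc eqX); apply: contraNneq => ->.
by rewrite /discD /disc /=; apply/eqP; ring.
Qed.

(** Cubics with and without a zero are told apart by the degree of their splitting
   field: at most 2 for the former, 3 or 6 for the latter. *)
Lemma split_field_has_zero (K : fieldExtType F) (X Y : datum F) :
  discD X != 0 -> dt X = 0 -> du X = 0 -> dt Y = 0 -> du Y = 0 ->
  is_split_field K X -> is_split_field K Y -> has_zero X -> ~ ~ has_zero Y.
Proof.
move=> dX tX uX tY uY sX sY zX zY.
have [A A0 eqX] := normal_has_zero two_neq0 three_neq0 dX tX uX zX.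
have sA := (is_split_field_dequiv K eqX).1 sX.
have le2 := dim_split_quadratic A0 (oner_neq0 F) sA.
have [P [Q eqY]] := normal_monic three_neq0 (no_zero_dA zY) tY uY.
have nzY : ~ has_zero (Datum 1 0 P Q 0 0).
  by move=> /(dequiv_has_zero (dequiv_sym eqY)).
have := dim_split_cubic nzY ((is_split_field_dequiv K eqY).1 sY).
by move: le2; rewrite !inE => + /orP[]/eqP e3; rewrite e3.
Qed.

Lemma cardano_equiv (K : fieldExtType F) (X1 X2 : datum F) :
  discD X1 != 0 -> discD X2 != 0 ->
  Cardano (nuD X1) -> nuD X1 = nuD X2 ->
  is_split_field K X1 -> is_split_field K X2 -> dequiv X1 X2.
Proof.
move=> d1 d2 c1 eq_nu s1 s2; have [nu0|/eqP nu0] := eqVneq (nuD X1) (0, 0).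
  have [t1 u1] := nu0_tau two_neq0 three_neq0 d1 nu0.
  have [t2 u2] := nu0_tau two_neq0 three_neq0 d2 (etrans (esym eq_nu) nu0).
  have [z1|z1] := zero_or_not three_neq0 s1 t1 u1;
    have [z2|z2] := zero_or_not three_neq0 s2 t2 u2.
  - have [A1 A10 eq1] := normal_has_zero two_neq0 three_neq0 d1 t1 u1 z1.
    have [A2 A20 eq2] := normal_has_zero two_neq0 three_neq0 d2 t2 u2 z2.
    apply: (dequiv_trans eq1 (dequiv_trans _ (dequiv_sym eq2))).
    by apply: split_quadratic_equiv => //; [exact: oner_neq0 |
      exact/(is_split_field_dequiv K eq1) | exact/(is_split_field_dequiv K eq2)].
  - by case: (split_field_has_zero d1 t1 u1 t2 u2 s1 s2 z1 z2).
  - by case: (split_field_has_zero d2 t2 u2 t1 u1 s2 s1 z2 z1).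
  have [P1 [Q1 eq1]] := normal_monic three_neq0 (no_zero_dA z1) t1 u1.
  have [P2 [Q2 eq2]] := normal_monic three_neq0 (no_zero_dA z2) t2 u2.
  apply: (dequiv_trans eq1 (dequiv_trans _ (dequiv_sym eq2))).
  apply: (@split_cubic_equiv F K).
  - by rewrite -(dequiv_disc eq2).
  - by move=> /(dequiv_has_zero (dequiv_sym eq1)).
  - by move=> /(dequiv_has_zero (dequiv_sym eq2)).
  - exact/(is_split_field_dequiv K eq1).
  - exact/(is_split_field_dequiv K eq2).
have c2 : Cardano (nuD X2) by rewrite -eq_nu.
have nu0' : nuD X2 <> (0, 0) by rewrite -eq_nu.
have C0 := midcoef_neq0 d1 c1 nu0.
have [A1 A10 eq1] := normal_cardano two_neq0 three_neq0 d1 c1 nu0.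
have [A2 A20 eq2] := normal_cardano two_neq0 three_neq0 d2 c2 nu0'.
rewrite -eq_nu in eq2.
apply: (dequiv_trans eq1 (dequiv_trans _ (dequiv_sym eq2))).
apply: split_quadratic_equiv => //.
- exact/(is_split_field_dequiv K eq1).
- exact/(is_split_field_dequiv K eq2).
Qed.

Lemma cardano_orbit m1 m2 (K1 K2 : fieldExtType F) :
  generic e m1 -> generic e m2 -> Cardano (nu e m1) ->
  is_splitting_field (fund_cubic e m1) K1 ->
  is_splitting_field (fund_cubic e m2) K2 ->
  same_orbit m1 m2 <-> nu e m1 = nu e m2 /\ ext_equiv K1 K2.
Proof.
move=> g1 g2 c1 /(split_field_datum e two_neq0) s1 /(split_field_datum e two_neq0) s2.
have [_ d1] := (generic_datum e m1).1 g1.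
have [_ d2] := (generic_datum e m2).1 g2.
split=> [o12|[eq_nu [f fbij]]].
  split; first exact: nu_orbit.
  have /(same_orbit_datum three_neq0 e_basis g1 g2) eq12 := o12.
  apply: (split_field_unique two_neq0 three_neq0 d1 s1).
  exact/(is_split_field_dequiv K2 eq12).
apply/(same_orbit_datum three_neq0 e_basis g1 g2); rewrite !nu_datum in c1 eq_nu.
exact: cardano_equiv d1 d2 c1 eq_nu s1 (split_field_bij fbij s2).
Qed.

Lemma dim_split_cardano m (K : fieldExtType F) : generic e m ->
  is_splitting_field (fund_cubic e m) K ->
  Cardano (nu e m) -> nu e m <> (0, 0) -> (\dim {:K} <= 2)%N.
Proof.
move=> /generic_datum[_ dX] /(split_field_datum e two_neq0) sK.
rewrite nu_datum => cX nz0; have C0 := midcoef_neq0 dX cX nz0.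
have [A A0 eqX] := normal_cardano two_neq0 three_neq0 dX cX nz0.
exact: dim_split_quadratic A0 C0 ((is_split_field_dequiv K eqX).1 sK).
Qed.

Lemma exists_split_cardano (p : F * F) (K : fieldExtType F) :
  Cardano p -> p <> (0, 0) -> (\dim {:K} <= 2)%N -> exists m,
    [/\ generic e m, nu e m = p & is_splitting_field (fund_cubic e m) K].
Proof.
move=> cp p0 dimK; have p3 := Cardano_p1 two_neq0 three_neq0 cp p0.
have C0 : midcoef p != 0.
  have [d1 n1] := cardano_datum_nu two_neq0 three_neq0 cp p3 (oner_neq0 F).
  by rewrite -n1; apply: midcoef_neq0; rewrite ?n1.
have [A A0 sK] := exists_split_quadratic two_neq0 three_neq0 1 0 C0 dimK.
have [dX nX] := cardano_datum_nu two_neq0 three_neq0 cp p3 A0.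
have [m [gm nm mX]] := realize dX; exists m; split=> //; first by rewrite nm.
by apply/(split_field_datum e two_neq0); rewrite mX.
Qed.

Lemma dim_split_zero m (K : fieldExtType F) : generic e m ->
  is_splitting_field (fund_cubic e m) K -> nu e m = (0, 0) ->
  \dim {:K} \in [:: 1; 2; 3; 6]%N.
Proof.
move=> /generic_datum[_ dX] /(split_field_datum e two_neq0) sK.
rewrite nu_datum => nu0; have [t0 u0] := nu0_tau two_neq0 three_neq0 dX nu0.
have [z|z] := zero_or_not three_neq0 sK t0 u0.
  have [A A0 eqX] := normal_has_zero two_neq0 three_neq0 dX t0 u0 z.
  have sA := (is_split_field_dequiv K eqX).1 sK.
  have := dim_split_quadratic A0 (oner_neq0 F) sA.
  have : (0 < \dim {:K})%N := adim_gt0 _.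
  by case: (\dim _) => [|[|[|n]]].
have [P [Q eqX]] := normal_monic three_neq0 (no_zero_dA z) t0 u0.
have nzX : ~ has_zero (Datum 1 0 P Q 0 0).
  by move=> /(dequiv_has_zero (dequiv_sym eqX)).
have := dim_split_cubic nzX ((is_split_field_dequiv K eqX).1 sK).
by rewrite !inE => /orP[]/eqP->.
Qed.

(** Associativity can be tested on normal forms; the only associative ones are
   x (A x^2 + y^2 / 2) with tau = (1, 0), for which nu is (16, -12). *)
Lemma associative_nu m : generic e m -> associative m <-> nu e m = (16, -12).
Proof.
move=> gm; have [_ dX] := (generic_datum e m).1 gm; rewrite nu_datum.
have n16 : (16 : F) != 0 by nz.
have mid : midcoef ((16, -12) : F * F) = 1 / 2 by rewrite /midcoef /=; field; nz.
split=> [mA|nuE].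
  have [[t0 u0]|[Y [eqXY t1 u0]]] := normal_tau (D m).
    have := (associative_dequiv three_neq0 e_basis gm (dequiv_refl (D m))).1 mA.
    by case/(assoc_tau two_neq0 three_neq0 dX t0 u0).
  have [Z [eqXZ tZ uZ AB]] : exists Z,
      [/\ dequiv (D m) Z, dt Z = 1, du Z = 0 & dA Z = 0 \/ dB Z = 0].
    have [A0|A0] := eqVneq (dA Y) 0; first by exists Y; split=> //; left.
    case: Y t1 u0 A0 eqXY => A B C E t u /= -> -> A0 eqXY.
    have [C' [D' eq1]] := shear three_neq0 B C E 1 A0.
    exists (Datum A 0 C' D' 1 0); split=> //; last by right.
    exact: dequiv_trans eqXY eq1.
  have ZA := (associative_dequiv three_neq0 e_basis gm eqXZ).1 mA.
  rewrite (dequiv_nu eqXZ); move: dX; rewrite (dequiv_disc eqXZ).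
  case: Z tZ uZ AB ZA {eqXZ} => A B C E t u /= -> -> AB ZA dZ.
  have [A0 -> -> ->] := assoc_normal two_neq0 three_neq0 dZ AB ZA.
  rewrite -mid; apply: (cardano_datum_nu _ _ _ _ A0).2 => //.
  by rewrite /Cardano /=; apply/eqP; ring.
have cX : Cardano (nuD (D m)) by rewrite nuE /Cardano /=; apply/eqP; ring.
have nz0 : nuD (D m) <> (0, 0) by rewrite nuE => - [] /eqP; rewrite (negbTE n16).
have [A A0] := normal_cardano two_neq0 three_neq0 dX cX nz0.
rewrite nuE mid => eqX; apply/(associative_dequiv three_neq0 e_basis gm eqX).
exact: assoc_datum.
Qed.

Lemma split_automorphisms m (K : fieldExtType F) : generic e m ->
  is_splitting_field (fund_cubic e m) K ->
  [/\ ~~ Cardano (nu e m) ->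
        aut_isog (@extend_scalars F V e K m) (1%G : {group 'S_3}),
      Cardano (nu e m) -> nu e m <> (0, 0) ->
        aut_isog (@extend_scalars F V e K m) [set: 'Z_2]%G
    & nu e m = (0, 0) ->
        aut_isog (@extend_scalars F V e K m) [set: 'S_3]%G].
Proof.
move=> /generic_datum[mC dX] /(split_field_datum e two_neq0) sK; rewrite nu_datum.
have n2 := two_neq0K K two_neq0; have n3 := three_neq0K K three_neq0.
have dK : discD (map_datum (emb K) (D m)) != 0 by rewrite discD_map fmorph_eq0.
split=> [nC|cX nz0|nu0]; apply: aut_isog_extend => //.
- by apply: stab_noncardano => //; rewrite nuD_map Cardano_map.
- apply: stab_cardano => //; first by rewrite nuD_map Cardano_map.
  rewrite nuD_map => - [] /eqP + /eqP; rewrite !fmorph_eq0 => /eqP p3 /eqP p2.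
  by apply: nz0; rewrite /nuD p3 p2.
have [t0 u0] := nu0_tau two_neq0 three_neq0 dX nu0.
have [[al [be [_ prodE]]] _] := sK.
apply: stab_split => //; apply: (@normal_split _ _ al be) => //.
- by rewrite -[LHS]/(emb K (dt (D m))) t0 rmorph0.
- by rewrite -[LHS]/(emb K (du (D m))) u0 rmorph0.
Qed.

End Classification.

Theorem theorem1p2 (F : fieldType) (V : vectType F) (e : 2.-tuple V)
    (char2 : 2%N \notin [pchar F]) (char3 : 3%N \notin [pchar F])
    (dimV : \dim {:V} = 2%N) (e_basis : basis_of {:V} e) :
  (* (i) *)
  (forall p : F * F,
     exists m : {bilinear V -> V -> V}, generic e m /\ nu e m = p)
  /\
  (* (ii) *)
  (forall m1 m2 : {bilinear V -> V -> V}, generic e m1 -> generic e m2 ->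
     ~~ Cardano (nu e m1) -> ~~ Cardano (nu e m2) ->
     (same_orbit m1 m2 <-> nu e m1 = nu e m2))
  /\
  (* (iii) *)
  (forall (m1 m2 : {bilinear V -> V -> V}) (K1 K2 : fieldExtType F),
     generic e m1 -> generic e m2 ->
     Cardano (nu e m1) -> Cardano (nu e m2) ->
     is_splitting_field (fund_cubic e m1) K1 ->
     is_splitting_field (fund_cubic e m2) K2 ->
     (same_orbit m1 m2 <-> nu e m1 = nu e m2 /\ ext_equiv K1 K2))
  /\
  (* (iv)(a) *)
  ((forall (m : {bilinear V -> V -> V}) (K : fieldExtType F),
      generic e m -> is_splitting_field (fund_cubic e m) K ->
      Cardano (nu e m) -> nu e m <> (0, 0) -> (\dim {:K} <= 2)%N) /\
   (forall (p : F * F) (K : fieldExtType F),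
      Cardano p -> p <> (0, 0) -> (\dim {:K} <= 2)%N ->
      exists m : {bilinear V -> V -> V},
        [/\ generic e m, nu e m = p & is_splitting_field (fund_cubic e m) K]))
  /\
  (* (iv)(b) *)
  ((forall (m : {bilinear V -> V -> V}) (K : fieldExtType F),
      generic e m -> is_splitting_field (fund_cubic e m) K ->
      nu e m = (0, 0) -> \dim {:K} \in [:: 1; 2; 3; 6]%N) /\
   (forall K : splittingFieldType F,
      galois 1 {:K} -> (\dim {:K} <= 6)%N ->
      (* Not in the source, but necessary: without it the claim fails for
         extensions of degree 4 or 5 and for cyclic ones of degree 6. *)
      (exists H : {group 'S_3}, 'Gal({:K} / 1) \isog H) ->
      exists m : {bilinear V -> V -> V},
        [/\ generic e m, nu e m = (0, 0)
          & is_splitting_field (fund_cubic e m) K]))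
  /\
  (* (v) *)
  (forall m : {bilinear V -> V -> V}, generic e m ->
     (associative m <-> nu e m = (16, -12)))
  /\
  (* (vi) *)
  (forall (m : {bilinear V -> V -> V}) (K : fieldExtType F),
     generic e m -> is_splitting_field (fund_cubic e m) K ->
     [/\ ~~ Cardano (nu e m) ->
           aut_isog (@extend_scalars F V e K m) (1%G : {group 'S_3}),
         Cardano (nu e m) -> nu e m <> (0, 0) ->
           aut_isog (@extend_scalars F V e K m) [set: 'Z_2]%G
       & nu e m = (0, 0) ->
           aut_isog (@extend_scalars F V e K m) [set: 'S_3]%G]).
Proof.
have n2 : (2 : F) != 0 by move: char2; rewrite inE.
have n3 : (3 : F) != 0 by move: char3; rewrite inE.
split; [|split; [|split; [|split; [split|split; [split|split]]]]].
- move=> p; have [X [dX nX]] := nuD_onto n2 n3 p.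
  by have [m [gm nm _]] := realize n3 e_basis dX; exists m; rewrite nm.
- move=> m1 m2 g1 g2 nC1 _; split; first exact: nu_orbit n3 e_basis _ _ g1 g2.
  exact: noncardano_orbit n2 n3 e_basis _ _ g1 g2 nC1.
- by move=> m1 m2 K1 K2 g1 g2 c1 _; apply: cardano_orbit.
- exact: dim_split_cardano.
- exact: exists_split_cardano.
- exact: dim_split_zero.
- move=> K galK _ [H isoH].
  have [X [[t0 u0] dX sK]] := exists_split_zero_tau n2 n3 galK isoH.
  have [m [gm nm mX]] := realize n3 e_basis dX; exists m; split=> //.
    by rewrite nm; case: X t0 u0 {dX sK nm mX} => A B C D t u /= -> ->; apply: tau0_nu.
  by apply/(split_field_datum e n2); rewrite mX.
- exact: associative_nu.
- exact: split_automorphisms.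
Qed.
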